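(* Let $k\geq 4$ be an integer, and let $G$ be a finite insoluble group of minimal order among all finite insoluble groups having an element $x$ such that $[u_1,\ldots,u_k]=1$ for every $u_1,\ldots,u_k$ in the solubilizer of $x$. Let $x \in G$ be such that $[u_1,\ldots,u_k]=1$ for every $u_1,\ldots,u_k\in \mathrm{Sol}_G(x)$. Then $G$ has a unique minimal normal subgroup $K$, and $K = S\times\cdots\times S$ (a direct product of finitely many copies of $S$), where $S$ is isomorphic either to $\mathrm{PSL}(2,q)$ with $q$ odd and $q\geq 5$, or to the alternating group $\mathrm{Alt}(7)$. Furthermore, $G=K\langle x\rangle$ and $\mathrm{Sol}_G(x)$ is a Sylow $2$-subgroup of $G$.
   Context: For a finite group $G$ and $x \in G$, the solubilizer of $x$ in $G$ is the subset $\mathrm{Sol}_G(x)=\{y \in G \mid \langle x,y\rangle \text{ is soluble}\}$ (not a subgroup in general). Insoluble means not soluble. Long commutators of weight $k\ge 2$ are defined inductively by $[x_1,x_2]=x_1^{-1}x_2^{-1}x_1x_2$ and $[x_1,\ldots,x_k]=[[x_1,\ldots,x_{k-1}],x_k]$ for $k>2$. $\mathrm{PSL}(2,q)$ is the projective special linear group of degree $2$ over the field with $q$ elements ($q$ a prime power). *)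

(* Defs.v *)
From HB Require Import structures.
From mathcomp Require Import all_boot all_order all_algebra all_fingroup all_solvable.

Set Implicit Arguments.
Unset Strict Implicit.
Unset Printing Implicit Defensive.

Import GroupScope.

Section Solubilizer.

Variable gT : finGroupType.
Implicit Types (x : gT) (s : seq gT) (G K S : {group gT}).

Definition solubilizer G x : {set gT} :=
  [set y in G | solvable <<[set x; y]>>].

(* The left-normed commutator [x_1, ..., x_k]; only used for k >= 2, the
   values on shorter sequences being conventional. *)
Definition long_commg s : gT :=
  if s is u :: s' then foldl (@commg gT) u s' else 1.

Definition trivial_long_comm_sol (k : nat) G x : Prop :=
  forall u : k.-tuple gT,
    (forall i : 'I_k, tnth u i \in solubilizer G x) -> long_commg u = 1.

Definition insoluble_with_trivial_long_comm (k : nat) G : Prop :=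
  ~~ solvable G /\ exists2 x, x \in G & trivial_long_comm_sol k G x.

(* minnormal K G alone does not require K to be contained in G. *)
Definition minimal_normal_subgroup G K : bool :=
  (K \subset G) && minnormal K G.

(* K is an internal direct product of n >= 1 subgroups isomorphic to S. *)
Definition direct_power_of K S : Prop :=
  exists (n : nat) (H : 'I_n -> {group gT}),
    [/\ 0 < n, \big[dprod/1]_(i < n) H i = K
      & forall i : 'I_n, H i \isog S].

End Solubilizer.

Definition minimal_insoluble_with_trivial_long_comm
    (k : nat) (gT : finGroupType) (G : {group gT}) : Prop :=
  insoluble_with_trivial_long_comm k G /\
  forall (hT : finGroupType) (H : {group hT}),
    insoluble_with_trivial_long_comm k H -> #|G| <= #|H|.

Section ProjectiveSpecialLinear.

(* As for {'GL_n[F]}, the matrices have dimension n.-1.+1, i.e., n for n > 0. *)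
Variables (n : nat) (F : finFieldType).

Definition SL : {set {'GL_n[F]}} := [set A | (\det (GLval A) == 1)%R].

Lemma SL_group_set : group_set SL.
Proof.
apply/group_setP; split=> [|A B]; first by rewrite inE GL_1E det1.
by rewrite !inE GL_ME det_mulmx => /eqP-> /eqP->; rewrite GRing.mul1r.
Qed.
Canonical SL_group := Group SL_group_set.

Definition PSL : {group coset_of 'Z(SL)} := (SL / 'Z(SL))%G.

End ProjectiveSpecialLinear.

(* Main.v *)
Require Import Defs.
From HB Require Import structures.
From mathcomp Require Import all_boot all_order all_algebra all_fingroup all_solvable.
From mathcomp Require Import all_character ring.

Set Implicit Arguments.
Unset Strict Implicit.
Unset Printing Implicit Defensive.

Import GroupScope FiniteModule GRing.Theory.

(* The group PGL(2,7), of order 336, contains an element of order 8 whose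
   solubilizer is a dihedral Sylow 2-subgroup of order 16, hence of class 3.
   So a minimal G has order at most 336, whatever k >= 4 is, and only small
   orders matter. By minimality G has trivial soluble radical and every proper
   subgroup containing x is soluble, hence nilpotent; therefore G = N<x> for
   every nontrivial normal N, and x lies in a unique maximal subgroup M, which
   is nilpotent, equals the solubilizer of x and is the normaliser of each of
   its nontrivial normal subgroups. Burnside transfer makes M a nonabelian
   Sylow 2-subgroup, the focal subgroup theorem excludes |M| = 8, and so |G| is
   240 or 336. Counting Sylow 5-subgroups excludes 240. For 336, the action on
   the eight Sylow 7-subgroups is the action of PGL(2,7) on the projective line,
   and the minimal normal subgroup is the image of SL(2,7). *)

(** * Transfer *)

(** Bounding the order by 336 lets two theorems of Burnside, on normal complements and on orders
    [p ^ a * q ^ b], settle solubility, with the few remaining orders checked by computation. Odd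
    primes leave [M] because a nonabelian [p]-group has order at least [p ^ 3]. Order 8 falls
    because a noncentral element then has a centraliser of index 2 in [M]. Conjugation in [G]
    between elements of [M] therefore changes them only by central factors, so [M] meets the derived
    subgroup of [G] inside its centre. As the quotient of [G] by its derived subgroup is cyclic, [M]
    would be abelian. Recognition rests on 336 = 8 * 7 * 6. This equality leaves no freedom once
    three Sylow 7-subgroups are labelled infinity, 0 and 1: [G] is generated by elements acting as t
    + 1, 3 t and 1 / t. A nontrivial normal subgroup has a 2-group as quotient, hence contains all
    odd Sylow subgroups and has order at least 168. This gives both the uniqueness of [K] and its
    identification with the image of SL(2,7). *)

Section Transfer.

Variable gT : finGroupType.
Implicit Types (G P F K : {group gT}) (p : nat).

(** The transfer to [P / F] kills commutators. Its expansion over the cycles of [a] on cosets of [P]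
    is a product of conjugates of powers of [a], which the fusion hypothesis makes congruent to
    those powers modulo [F]. The exponents add up to [#|G : P|], which is prime to [p]. *)
Lemma focal_subgroup_sub p G P F :
    p.-Sylow(G) P -> F <| P ->
    (forall a g, a \in P -> g \in G -> a ^ g \in P -> [~ a, g] \in F) ->
  P :&: G^`(1) \subset F.
Proof.
move=> sylP nsFP focal; have sPG := pHall_sub sylP.
have nFP := normal_norm nsFP.
have sP'F : P^`(1) \subset F.
  rewrite gen_subG; apply/subsetP=> _ /imset2P[a b Pa Pb ->].
  by apply: focal; rewrite ?groupJ ?(subsetP sPG).
pose alpha := restrm_morphism nFP (coset_morphism F).
have alphaE : alpha @* P = P / F by rewrite morphim_restrm setIid.
have abPF : abelian (alpha @* P) by rewrite alphaE sub_der1_abelian.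
pose V := transfer_morphism G abPF.
apply/subsetP=> a /setIP[Pa G'a]; have Ga := subsetP sPG a Pa.
have Va0 : transfer G abPF a = 0%R.
  have sub : G^`(1) \subset 'ker V.
    rewrite gen_subG; apply/subsetP=> _ /imset2P[b c Gb Gc ->].
    apply/kerP; first by rewrite groupR.
    rewrite morphR //; apply/eqP/commgP.
    exact: GRing.addrC.
  by have /mker := subsetP sub a G'a.
have trX := transversalP (rcosets_cycle_partition sPG Ga).
set X := transversal _ _ in trX.
have sXG := subsetP (transversal_sub trX).
have fmod0 : (fmod abPF (alpha a) *+ #|G : P| = 0)%R.
  rewrite -Va0 (transfer_cycle_expansion sPG abPF Ga trX).
  rewrite -(sum_index_rcosets_cycle sPG Ga trX) -GRing.sumrMnr.
  apply: eq_bigr => y Xy /=; set n := #|_ : _|.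
  have Pn := mulg_exp_card_rcosets P a y; rewrite -/n mem_rcoset in Pn.
  have Pn' : (a ^+ n) ^ y^-1 \in P by rewrite conjgE invgK mulgA.
  have Aa : coset F a \in alpha @* P by rewrite alphaE mem_quotient.
  rewrite /= /restrm /= -(fmodX abPF n Aa) -/n; congr (fmod abPF _).
  rewrite -morphX ?(subsetP nFP) //=.
  have -> : a ^+ n ^ y^-1 = a ^+ n * [~ a ^+ n, y^-1] by rewrite commgEl mulKVg.
  by rewrite coset_kerr // focal ?groupX ?groupV ?sXG.
have : alpha a ^+ #|G : P| = 1.
  have Aa : alpha a \in alpha @* P by rewrite alphaE mem_quotient.
  by rewrite -(fmodK abPF Aa) -fmvalZ fmod0.
rewrite /alpha /= /restrm => a1.
apply: coset_idr; first exact: subsetP nFP _ Pa.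
have co : coprime #|P / F| #|G : P|.
  have /pHallP[_ oP] := sylP.
  have pPF : p.-group (P / F) by rewrite quotient_pgroup ?(pHall_pgroup sylP).
  by apply: pnat_coprime pPF _; case/and3P: sylP.
by rewrite -(expgK co (mem_quotient F Pa)) a1 expg1n.
Qed.

Lemma Burnside_normal_complement p G P :
    p.-Sylow(G) P -> P \subset 'C('N_G(P)) ->
  exists K : {group gT}, [/\ K <| G, K * P = G & p^'.-group K].
Proof.
move=> sylP cNP; have sPG := pHall_sub sylP.
have abP : abelian P.
  by apply: subset_trans cNP _; rewrite centS // subsetI sPG normG.
have foc : P :&: G^`(1) \subset 1%G.
  apply: (focal_subgroup_sub sylP (normal1 P)) => a g Pa Gg Pag.
  (* Since [P] is abelian, both [P] and [P :^ g] are Sylow in the centraliser of [a ^ g].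
     Conjugating one to the other there replaces [g] by an element of the normaliser of [P], which
     centralises [a]. *)
  have sylPc : p.-Sylow('C_G[a ^ g]) P.
    apply: pHall_subl _ (subsetIl _ _) sylP.
    by rewrite subsetI sPG sub_cent1 (subsetP abP).
  have sylPgc : p.-Sylow('C_G[a ^ g]) (P :^ g).
    apply: (pHall_subl _ (subsetIl _ _)); last by rewrite pHallJ.
    rewrite subsetI conj_subG // sub_cent1 centJ memJ_conjg.
    exact: subsetP abP _ Pa.
  have [h /setIP[Gh ch]] := Sylow_trans sylPgc sylPc.
  rewrite -conjsgM /= => defP.
  have Ngh : g * h \in 'N_G(P) by rewrite inE groupM //= inE -defP.
  have /commgP/conjg_fixP agh : commute a (g * h).
    exact: (centP (subsetP cNP a Pa)).
  have /commgP/conjg_fixP agH : commute (a ^ g) h by apply/commute_sym/cent1P.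
  by apply/set1P; rewrite commgEl -agH -conjgM agh mulVg.
have nsG'G : G^`(1) <| G := der_normal 1 G.
have p'G' : p^'.-group G^`(1).
  have sylPG' := Hall_setI_normal nsG'G sylP.
  by rewrite -partG_eq1 -(card_Hall sylPG') (trivgP foc) cards1.
have nilGG' : nilpotent (G / G^`(1)) by rewrite abelian_nil // sub_der1_abelian.
have [K defK sG'K nsKG] := inv_quotientN nsG'G (pcore_normal p^' (G / G^`(1))).
have sKG := normal_sub nsKG.
exists K; split=> //; last first.
  rewrite /pgroup -(Lagrange sG'K) pnatM [pnat _ _]p'G'.
  rewrite -card_quotient ?(subset_trans sKG) ?normal_norm //.
  by have := pcore_pgroup p^' (G / G^`(1)); rewrite defK.
apply: coprime_index_mulG => //.
have /and3P[_ _ piK] := nilpotent_pcore_Hall p^' nilGG'.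
have /and3P[_ _ p'iP] := sylP; apply: pnat_coprime p'iP.
rewrite defK pnatNK in piK.
by rewrite -(index_quotient_eq _ sKG (normal_norm nsG'G)) //=
  (subset_trans (subsetIr _ _)).
Qed.

End Transfer.

(** * Groups of order at most 336 *)

(** Reduces the numerical facts below to one boolean evaluation. Their guards are written with [if]
    so that [vm_compute] evaluates only one branch. *)
Lemma all_iotaP (f : pred nat) N :
  all f (iota 0 N) -> forall n, n < N -> f n.
Proof. by move=> /allP fN n ltnN; apply: fN; rewrite mem_iota. Qed.

(** The second alternative is for 105 and 165, whose smallest prime 3 occurs once. The bound 168 is
    half of 336. *)
Fact odd_order_le168 n : n < 169 ->
  if odd n then (size (primes n) <= 2) ||
    (logn (pdiv n) n == 1%N) && (size (primes (n %/ pdiv n)) <= 2)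
  else true.
Proof. by move: n; apply: all_iotaP; vm_compute. Qed.

Fact order_2mod4_le336 n : n < 337 ->
  if odd n || (4 %| n) then true else
  [&& pdiv n == 2, logn 2 n == 1%N & odd (n %/ 2)].
Proof. by move: n; apply: all_iotaP; vm_compute. Qed.

(** Serves to show that a normal [q]-complement of such an order [n] cannot occur in a group of
    order at most 336. *)
Fact order_4dvd_le168 n : n < 169 ->
  if 4 %| n then if 2 < size (primes n) then
    all (fun q => if prime q then (n * q <= 336) ==> (q %| n) else true) (iota 0 337)
  else true else true.
Proof. by move: n; apply: all_iotaP; vm_compute. Qed.

(** The parity condition keeps out 270 = 2 * 27 * 5. Orders congruent to 2 modulo 4 are handled by
    [solvable_2mod4]. *)
Fact order_cube_dvd_le336 n q :
    0 < n < 337 -> 2 < size (primes n) -> odd n || (4 %| n) ->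
  prime q -> q != 2 -> q < 7 -> ~~ (q ^ 3 %| n).
Proof.
move=> /andP[n_gt0 ltn] n3 n4 pr_q q2 ltq.
pose f m := if [|| m == 0, size (primes m) <= 2 | ~~ (odd m || (4 %| m))]
  then true else
    all (fun q => if prime q then (q != 2) ==> ~~ (q ^ 3 %| m) else true) (iota 0 7).
have /all_iotaP/(_ n ltn) : all f (iota 0 337) by vm_compute.
rewrite /f n4 -[_ == 0]negbK -lt0n n_gt0 leqNgt n3 => /all_iotaP/(_ q ltq).
by rewrite pr_q q2.
Qed.

Fact order_16dvd_le336 n : n < 337 ->
  if 16 %| n then
    [|| n == 0, size (primes n) <= 2, n == 240 | n == 336] else true.
Proof. by move: n; apply: all_iotaP; vm_compute. Qed.

Section SmallOrders.

Variable gT : finGroupType.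
Implicit Types (G P K : {group gT}) (p : nat).

(** The conjugates of a generator under the normaliser are nontrivial elements of [P], so there are
    fewer of them than the smallest prime divisor of [#|G|]. Their number divides [#|G|], so it is
    1. *)
Lemma pdiv_Sylow_cent_norm G P :
  P \subset G -> #|P| = pdiv #|G| -> P \subset 'C('N_G(P)).
Proof.
move=> sPG oP; have [G1 | ntG] := eqsVneq G 1.
  by rewrite (subset_trans sPG) // G1 sub1G.
have prP : prime #|P| by rewrite oP pdiv_prime // cardG_gt1.
have [a defP] := cyclicP (prime_cyclic prP).
have Pa : a \in P by rewrite defP cycle_id.
have nta : a != 1 by rewrite -cycle_eq1 -defP -cardG_gt1 prime_gt1.
rewrite centsC defP cent_cycle.
have sub : a ^: 'N_G(P) \subset P :\ 1.
  apply/subsetP=> _ /imsetP[g /setIP[_ Ng] ->].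
  by rewrite !inE conjg_eq1 nta memJ_norm.
have ltp : #|'N_G(P) : 'C_('N_G(P))[a]| < pdiv #|G|.
  rewrite index_cent1 (leq_ltn_trans (subset_leq_card sub)) //.
  by rewrite -oP [#|P|](cardsD1 1) group1.
rewrite -defP; apply/setIidPl/eqP.
have dv : #|'N_G(P) : 'C_('N_G(P))[a]| %| #|G|.
  by rewrite (dvdn_trans (dvdn_indexg _ _)) ?cardSg ?subsetIl.
rewrite eqEcard subsetIl /= -(Lagrange (subsetIl 'N_G(P) 'C[a])).
rewrite -{2}(muln1 #|_|) leq_mul2l leqNgt orbC; apply/orP; left.
by apply/negP=> gt1; have := pdiv_min_dvd gt1 dv; rewrite leqNgt ltp.
Qed.

Lemma complement_solvable p G P K :
  p.-Sylow(G) P -> K <| G -> K * P = G -> solvable K -> solvable G.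
Proof.
move=> sylP nsKG defG solK; rewrite (series_sol nsKG) solK -defG.
by rewrite quotientMidl quotient_sol // (pgroup_sol (pHall_pgroup sylP)).
Qed.

Lemma card_complement p G P K :
  p.-Sylow(G) P -> K * P = G -> p^'.-group K -> (#|K| * #|P|)%N = #|G|.
Proof.
move=> sylP <- p'K; rewrite TI_cardMg //.
by apply/coprime_TIg; rewrite coprime_sym (pnat_coprime (pHall_pgroup sylP)).
Qed.

(** The Sylow subgroup for the smallest prime has prime order, so it has a normal complement, whose
    order is the given quotient. *)
Lemma pdiv_solvable G :
    logn (pdiv #|G|) #|G| = 1%N ->
    (forall K, #|K| = #|G| %/ pdiv #|G| -> solvable K) -> solvable G.
Proof.
move=> log1 solK; have [P sylP] := Sylow_exists (pdiv #|G|) G.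
have oP' : #|P| = pdiv #|G| by rewrite (card_Hall sylP) p_part log1 expn1.
have [K [nsKG defG p'K]] := Burnside_normal_complement sylP
  (pdiv_Sylow_cent_norm (pHall_sub sylP) oP').
apply: (complement_solvable sylP nsKG defG (solK _ _)).
by rewrite -{1}(card_complement sylP defG p'K) oP' mulnK ?pdiv_gt0.
Qed.

Lemma solvable_odd_le168 G : odd #|G| -> #|G| <= 168 -> solvable G.
Proof.
move=> oddG leG; have := odd_order_le168 leG; rewrite oddG.
case/orP=> [|/andP[/eqP o2 le2]]; first exact: Burnside_p_a_q_b.
by apply: pdiv_solvable o2 _ => K oK; apply: Burnside_p_a_q_b; rewrite oK.
Qed.

Lemma solvable_2mod4 G : ~~ odd #|G| -> ~~ (4 %| #|G|) -> #|G| <= 336 -> solvable G.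
Proof.
move=> evG n4G leG.
have := order_2mod4_le336 leG; rewrite (negPf evG) (negPf n4G).
case/and3P=> /eqP p2 /eqP n2 odd2.
apply: pdiv_solvable; rewrite p2 // => K oK.
by apply: solvable_odd_le168; rewrite oK // (leq_trans (leq_div2r 2 leG)).
Qed.

End SmallOrders.

(** * The nilpotent maximal subgroup containing x *)

Section MaximalNilpotent.

Variables (gT : finGroupType) (G : {group gT}) (x : gT).
Implicit Types (H M N C P K : {group gT}) (p : nat).

Hypotheses (Gx : x \in G) (ntx : x != 1) (nsolG : ~~ solvable G).
Hypothesis nilH : forall H, x \in H -> H \proper G -> nilpotent H.
Hypothesis radG : forall N, N <| G -> solvable N -> N :=: 1.

Lemma normal_mul_cycle N : N <| G -> N :!=: 1 -> N * <[x]> = G.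
Proof.
move=> nsNG ntN; have nNx : <[x]> \subset 'N(N).
  by rewrite cycle_subG (subsetP (normal_norm nsNG)).
have sub : N <*> <[x]> \subset G by rewrite join_subG normal_sub ?cycle_subG.
rewrite -norm_joinEr //; apply/eqP; rewrite eqEproper sub /=.
apply: contra ntN => prop; apply/eqP/radG => //.
apply: solvableS (joing_subl N <[x]>) _; apply/nilpotent_sol/nilH => //.
by rewrite -cycle_subG joing_subr.
Qed.

Lemma proper_normaliser C : C :!=: 1 -> solvable C -> C \subset G -> 'N_G(C) \proper G.
Proof.
move=> ntC solC sCG; rewrite properEneq subsetIl andbT.
apply: contra ntC => /eqP/setIidPl nCG.
by apply/eqP/radG => //; apply/andP.
Qed.

Definition maxover M := [max M of H | (x \in H) && (H \proper G)].

(** Induction towards larger intersections. Normalisers grow in the nilpotent groups [M1] and [M2],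
    so a maximal [M3] over the normaliser of [M1 :&: M2] meets each of them in more than
    [M1 :&: M2]. That normaliser is proper because the intersection is soluble and contains [x]. *)
Lemma maxover_unique M1 M2 : maxover M1 -> maxover M2 -> M1 :=: M2.
Proof.
have [n] := ubnP (#|G| - #|M1 :&: M2|); elim: n M1 M2 => // n IHn M1 M2 ltn maxM1 maxM2.
have /maxgroupP[/andP[xM1 pM1] mM1] := maxM1.
have /maxgroupP[/andP[xM2 pM2] mM2] := maxM2.
have xD : x \in M1 :&: M2 by rewrite inE xM1.
have [s12 | ns12] := boolP (M1 \subset M2).
  by rewrite (mM1 M2) ?xM2.
have [s21 | ns21] := boolP (M2 \subset M1).
  by rewrite -(mM2 M1) ?xM1.
have pD1 : M1 :&: M2 \proper M1 by rewrite properE subsetIl subsetI subxx.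
have pD2 : M1 :&: M2 \proper M2 by rewrite properE subsetIr subsetI subxx andbT.
have nil1 := nilH xM1 pM1; have nil2 := nilH xM2 pM2.
have pN1 := nilpotent_proper_norm nil1 pD1.
have pN2 := nilpotent_proper_norm nil2 pD2.
have xN : x \in 'N_G(M1 :&: M2) by rewrite inE Gx (subsetP (normG _)).
have pN : 'N_G(M1 :&: M2) \proper G.
  apply: proper_normaliser.
  - by apply: contraNneq ntx => D1; rewrite -in_set1 -[[set 1]]/(1 : {set gT}) -D1.
  - exact: solvableS (proper_sub pD1) (nilpotent_sol nil1).
  exact: subset_trans (proper_sub pD1) (proper_sub pM1).
have [M3 maxM3 sNM3] : {M | maxover M & 'N_G(M1 :&: M2) \subset M}.
  by apply: maxgroup_exists; rewrite xN.
have step M : M \subset G -> M1 :&: M2 \proper 'N_M(M1 :&: M2) ->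
    #|G| - #|M :&: M3| < n.
  move=> sMG pND; rewrite -ltnS; apply: leq_trans ltn; rewrite ltnS ltn_sub2l //.
    by rewrite (proper_card (sub_proper_trans (subsetIl _ _) pM1)).
  apply: leq_trans (proper_card pND) (subset_leq_card _).
  by rewrite subsetI subsetIl (subset_trans _ sNM3) ?setSI.
have -> : M1 :=: M3 by apply: IHn => //; apply: step pN1; apply: proper_sub.
by apply/esym/IHn => //; apply: step pN2; apply: proper_sub.
Qed.

Lemma proper_sub_maxover M H : maxover M -> x \in H -> H \proper G -> H \subset M.
Proof.
move=> maxM xH pH; have [M' maxM' sHM'] : {M | maxover M & H \subset M}.
  by apply: maxgroup_exists; rewrite xH.
by rewrite (maxover_unique maxM maxM').
Qed.

Lemma ex_maxover : {M | maxover M & <[x]> \subset M}.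
Proof.
apply: maxgroup_exists; rewrite cycle_id properEneq cycle_subG Gx andbT.
by apply: contraNneq nsolG => <-; rewrite abelian_sol ?cycle_abelian.
Qed.

Variable M : {group gT}.
Hypothesis maxM : maxover M.

Let xM : x \in M. Proof. by case/maxgroupP: maxM => /andP[]. Qed.
Let pM : M \proper G. Proof. by case/maxgroupP: maxM => /andP[]. Qed.
Let sMG := proper_sub pM.
Let nilM := nilH xM pM.

(** A soluble [<<[set x; y]>>] is proper and contains [x], so uniqueness puts it inside [M].
    Conversely [M] is nilpotent. *)
Lemma maxover_solubilizer : solubilizer G x = M.
Proof.
apply/setP=> y; rewrite inE; apply/andP/idP=> [[Gy solxy] | My].
  have sxyG : <<[set x; y]>> \subset G by rewrite gen_subG subUset !sub1set Gx.
  suff : <<[set x; y]>> \subset M by move/subsetP; apply; rewrite mem_gen ?set22.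
  apply: proper_sub_maxover => //; first by rewrite mem_gen ?set21.
  by rewrite properEneq sxyG andbT; apply: contraNneq nsolG => <-.
split; first exact: subsetP sMG y My.
apply: solvableS (nilpotent_sol nilM).
by rewrite gen_subG subUset !sub1set xM.
Qed.

Lemma maxover_norm C : C <| M -> C :!=: 1 -> 'N_G(C) = M.
Proof.
move=> /andP[sCM nCM] ntC; apply/eqP; rewrite eqEsubset subsetI sMG nCM !andbT.
apply: proper_sub_maxover => //; first by rewrite inE Gx (subsetP nCM).
apply: proper_normaliser => //; last exact: subset_trans sCM sMG.
exact: solvableS sCM (nilpotent_sol nilM).
Qed.

(** [P] is a core of the nilpotent [M], so its normaliser in [G] is [M]; being Sylow in one's own
    normaliser suffices. *)
Lemma maxover_Sylow p P : p.-Sylow(M) P -> P :!=: 1 -> p.-Sylow(G) P.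
Proof.
move=> sylP ntP; rewrite -Sylow_subnorm maxover_norm //.
by rewrite (nilpotent_Hall_pcore nilM sylP) pcore_normal.
Qed.

(** An abelian [P] would be central in [M], its own normaliser, and so have a normal complement [K]
    with [#|K| * p <= 336]. Then [K] is soluble by its order alone, or its order has three primes
    and is a multiple of 4, in which case [p] divides it, contradicting that [K] is a [p']-group. *)
Lemma maxover_Sylow_nonabelian p P :
  #|G| <= 336 -> p.-Sylow(M) P -> P :!=: 1 -> ~~ abelian P.
Proof.
move=> leG sylPM ntP; have sylP := maxover_Sylow sylPM ntP.
have nsPM : P <| M by rewrite (nilpotent_Hall_pcore nilM sylPM) pcore_normal.
apply: contra nsolG => abP.
have cPM : P \subset 'C('N_G(P)).
  rewrite maxover_norm // centsC.
  case/dprodP: (nilpotent_pcoreC p nilM) => _ defM cPp' _.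
  rewrite -(nilpotent_Hall_pcore nilM sylPM) in defM cPp'.
  by rewrite -defM mul_subG.
have [K [nsKG defG p'K]] := Burnside_normal_complement sylP cPM.
have oG := card_complement sylP defG p'K.
apply: (complement_solvable sylP nsKG defG).
have [pr_p pdvP [m oP]] := pgroup_pdiv (pHall_pgroup sylP) ntP.
have lePp : p <= #|P| by apply: dvdn_leq.
have leKp : #|K| * p <= 336 by rewrite (leq_trans _ leG) // -oG leq_mul2l lePp orbT.
have leK168 : #|K| <= 168.
  by rewrite -(leq_pmul2r (isT : 0 < 2)) (leq_trans _ leKp) // leq_mul2l prime_gt1 ?orbT.
have [oddK | evK] := boolP (odd #|K|); first exact: solvable_odd_le168.
have [K4 | ] := boolP (4 %| #|K|); last first.
  by move/(solvable_2mod4 evK); apply; apply: leq_trans leK168 _.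
apply: Burnside_p_a_q_b.
have [//|K3] := leqP (size (primes #|K|)) 2.
have ltp : p < 337 by rewrite ltnS (leq_trans _ leKp) // leq_pmull.
have := order_4dvd_le168 leK168; rewrite K4 K3 => /all_iotaP/(_ p ltp).
rewrite pr_p leKp implyTb => pK.
by have := p'K; rewrite /pgroup p'natE // pK.
Qed.

(** For an odd [p] dividing [#|M|], a nonabelian Sylow subgroup gives [p ^ 3] dividing [#|G|]. As 7
    ^ 3 = 343, only 3 and 5 are left, and those orders are soluble. *)
Lemma maxover_2group : #|G| <= 336 -> 2.-group M.
Proof.
move=> leG; apply/pgroupP=> p pr_p pM'; rewrite !inE; apply: contraNT nsolG => p2.
have [P sylPM] := Sylow_exists p M.
have ntP : P :!=: 1 by rewrite -rank_gt0 (rank_Sylow sylPM) p_rank_gt0 mem_primes pr_p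
    cardG_gt0.
have sylP := maxover_Sylow sylPM ntP.
have := maxover_Sylow_nonabelian leG sylPM ntP.
have pP := pHall_pgroup sylP.
have [|lt2 _] := leqP (logn p #|P|) 2; first by move/(p2group_abelian pP)->.
have p3 : p ^ 3 %| #|G|.
  by rewrite (dvdn_trans _ (cardSg (pHall_sub sylP))) // pfactor_dvdn.
have [le2 | gt2] := leqP (size (primes #|G|)) 2; first exact: Burnside_p_a_q_b.
have [n4 | ] := boolP (odd #|G| || (4 %| #|G|)); last first.
  by rewrite negb_or => /andP[evG n4G]; apply: solvable_2mod4.
suff ltp : p < 7.
  have ltG : 0 < #|G| < 337 by rewrite cardG_gt0.
  by have /negP[] := order_cube_dvd_le336 ltG gt2 n4 pr_p p2 ltp.
have := leq_trans (dvdn_leq (cardG_gt0 G) p3) leG; rewrite leqNgt; apply: contraNltn.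
by move=> p7; apply: leq_trans (_ : 7 ^ 3 <= _); rewrite ?leq_exp2r.
Qed.

(** * Fusion when the maximal nilpotent subgroup has order 8 *)

Section OrderEight.

Hypotheses (sylM : 2.-Sylow(G) M) (oM : #|M| = 8) (nabM : ~~ abelian M).

Let Z := 'Z(M)%G.

Let dvd8 n : n %| 8 -> n \in [:: 1; 2; 4; 8]%N.
Proof.
move=> dv; have : n <= 8 by apply: dvdn_leq.
by case: n dv => [|[|[|[|[|[|[|[|[|]]]]]]]]].
Qed.

Let oZ : #|Z| = 2.
Proof.
have ntM : M :!=: 1 by apply: contraNneq nabM => ->; apply: abelian1.
have dvZ : #|Z| %| 8 by rewrite -oM cardSg ?center_sub.
have oMZ : #|M / Z| = 8 %/ #|Z| by rewrite -oM -divg_normal ?center_normal.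
move: (dvd8 dvZ); rewrite !inE => /or4P[] /eqP o //; case/negP: nabM.
- suff : Z :!=: 1 by rewrite -cardG_gt1 o.
  by rewrite /= center_nil_eq1.
- by apply: cyclic_center_factor_abelian; rewrite prime_cyclic // oMZ o.
by apply/center_idP/eqP; rewrite eqEcard center_sub o oM.
Qed.

Let cMZ : M \subset 'C(Z). Proof. by rewrite centsC subsetIr. Qed.

Let derZ : M^`(1) \subset Z.
Proof.
apply: der1_min; first exact: normal_norm (center_normal M).
by apply: (@card_p2group_abelian _ 2) => //; rewrite -divg_normal ?center_normal // oM oZ.
Qed.

Let card_cent a : a \in M -> a \notin Z -> #|'C_M[a]| = 4.
Proof.
move=> Ma nZa; have dv : #|'C_M[a]| %| 8 by rewrite -oM cardSg ?subsetIl.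
have pZ : Z \proper 'C_M[a].
  rewrite properE subsetI center_sub sub_cent1 /=; apply/andP; split.
    exact: (subsetP cMZ).
  by apply: contra nZa => /subsetP; apply; rewrite inE Ma cent1id.
have gt2 := proper_card pZ; rewrite oZ in gt2.
move: (dvd8 dv); rewrite !inE => /or4P[] /eqP o; rewrite ?o // in gt2 *.
case/negP: nZa; rewrite inE Ma -sub_cent1.
suff /setIidPl : 'C_M[a] = M by [].
by apply/eqP; rewrite eqEcard subsetIl o oM.
Qed.

(** If [c ^ h] were noncentral, its centraliser [D] in [M] would have index 2 in both [M] and
    [M :^ h], since ['C_G[c]] lies in [M]. Both then normalise [D], whose normaliser is [M], so
    [M :^ h = M] and [c ^ h] is central after all. *)
Let center_fusion c h : c \in Z -> h \in G -> c ^ h \in M -> c ^ h \in Z.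
Proof.
move=> Zc Gh Mb; apply: contraT => nZb.
have /setIP[Mc cMc] := Zc.
have ntc : c != 1 by apply: contraNneq nZb => ->; rewrite conj1g group1.
have cGc : 'C_G[c] \subset M.
  have ns : <[c]> <| M by apply: sub_center_normal; rewrite cycle_subG.
  rewrite -(maxover_norm ns) ?cycle_eq1 // setIS // cents_norm //.
  by rewrite cent_cycle.
pose D := 'C_M[c ^ h]; have oD : #|D| = 4 by apply: card_cent.
have ntD : D :!=: 1 by rewrite -cardG_gt1 oD.
have sDMh : D \subset M :^ h.
  rewrite -sub_conjgV (subset_trans _ cGc) // subsetI.
  rewrite sub_conjgV conjGid // (subset_trans (subsetIl _ _)) //=.
  by rewrite sub_conjgV -cent1J subsetIr.
have nsD P : D \subset P -> #|P| = 8 -> D <| P.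
  move=> sDP oP; apply: index2_normal => //.
  by rewrite -divgS // oP oD.
have nDM := nsD M (subsetIl _ _) oM.
have := maxover_norm nDM ntD => defN.
have nDMh : D <| M :^ h by apply: nsD => //; rewrite cardJg.
have : M :^ h \subset 'N_G(D) by rewrite subsetI conj_subG // normal_norm.
rewrite defN => sMhM.
have defMh : M :^ h = M by apply/eqP; rewrite eqEcard sMhM cardJg leqnn.
by case/negP: nZb; rewrite inE Mb -sub_cent1 -{1}defMh cent1J conjSg sub_cent1.
Qed.

(** A larger Sylow subgroup would be a conjugate of [M] centralising [a], making [a] conjugate to a
    central element of [M]. *)
Let cent_Sylow a : a \in M -> a \notin Z -> 2.-Sylow('C_G[a]) 'C_M[a].
Proof.
move=> Ma nZa.
have p2C : 2.-group 'C_M[a] by apply: pgroupS (subsetIl _ _) (pHall_pgroup sylM).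
have [T sylT sCT] := Sylow_superset (setSI 'C[a] sMG) p2C.
have pT := pHall_pgroup sylT; have sTC := pHall_sub sylT.
have sTG := subset_trans sTC (subsetIl _ _).
have [h Gh sTMh] := Sylow_Jsub sylM sTG pT.
have dvT : #|T| %| 8 by rewrite -oM -(cardJg T h) cardSg.
have geT := subset_leq_card sCT; rewrite card_cent // in geT.
move: (dvd8 dvT); rewrite !inE => /or4P[] /eqP o; rewrite ?o // in geT *.
  suff -> : 'C_M[a] = T by [].
  by apply/eqP; rewrite eqEcard sCT card_cent // o.
have defM : T :^ h = M by apply/eqP; rewrite eqEcard sTMh cardJg o oM.
case/negP: nZa; rewrite -(conjgK h a); apply: center_fusion; rewrite ?groupV //.
  rewrite inE -sub_cent1 -{2}defM cent1J conjSg (subset_trans sTC) ?subsetIr // andbT.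
  by rewrite -defM memJ_conjg (subsetP sCT) // inE Ma cent1id.
by rewrite conjgK.
Qed.

(** For noncentral [a] and [a ^ g], Sylow conjugacy in the centraliser of [a ^ g] corrects [g] to
    [g * h] carrying ['C_M[a]] to ['C_M[a ^ g]]. Then [g * h] normalises [Z], so it lies in [M], and
    commutators of [M] are central. *)
Let fusion a g : a \in M -> g \in G -> a ^ g \in M -> [~ a, g] \in Z.
Proof.
move=> Ma Gg Mb; rewrite commgEl.
have [Za | nZa] := boolP (a \in Z).
  by rewrite groupMl ?groupV // center_fusion.
have [Zb | nZb] := boolP (a ^ g \in Z).
  by rewrite groupMr // groupV -(conjgK g a) center_fusion ?groupV ?conjgK.
have sylb := cent_Sylow Mb nZb.
have sylbg : 2.-Sylow('C_G[a ^ g]) ('C_M[a] :^ g).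
  by rewrite cent1J -{1}(conjGid Gg) -conjIg pHallJ2 cent_Sylow.
have [h /setIP[Gh /cent1P cbh] defC] := Sylow_trans sylbg sylb.
have Mgh : g * h \in M.
  have ZM : Z \subset 'C_M[a].
    by rewrite subsetI center_sub sub_cent1 (subsetP cMZ).
  have ntZ : Z :!=: 1 by rewrite -cardG_gt1 oZ.
  rewrite -(maxover_norm (center_normal M) ntZ) inE groupM //= inE.
  apply/subsetP=> _ /imsetP[z Zz ->]; apply: center_fusion => //.
    exact: groupM.
  have : z ^ (g * h) \in 'C_M[a ^ g].
    by rewrite defC conjgM !memJ_conjg (subsetP ZM).
  by case/setIP.
have -> : a ^ g = a ^ (g * h).
  by rewrite conjgM (conjg_fixP (introT commgP (commute_sym cbh))).
by rewrite -commgEl (subsetP derZ) // mem_commg.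
Qed.

(** [G / G^](1)[is generated by the image of]x[, so]M[is cyclic modulo its intersection with]G^[(1)].
    That intersection is central by the focal subgroup lemma, so [M] would be abelian. *)
Lemma maxover_card_neq8 : False.
Proof.
have foc := focal_subgroup_sub sylM (center_normal M) fusion.
have ntG' : G^`(1) != 1.
  by apply: contraNneq nsolG => /derG1P abG; apply: abelian_sol.
have defG := normal_mul_cycle (der_normal 1 G) ntG'.
case/negP: nabM.
have cycG : cyclic (G / G^`(1)).
  have := quotientMidl G^`(1) <[x]>; rewrite defG => ->.
  by rewrite quotient_cyclic ?cycle_cyclic.
have cycM : cyclic (M / G^`(1)) by apply: cyclicS cycG; apply: quotientS.
have nG'M : M \subset 'N(G^`(1)) := subset_trans sMG (der_norm 1 G).
have /isog_cyclic eqc := second_isog nG'M.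
rewrite /= -eqc in cycM.
by apply: cyclic_factor_abelian cycM; rewrite /= setIC.
Qed.

End OrderEight.

Lemma maxover_card : #|G| <= 336 -> #|G| = 240 \/ #|G| = 336.
Proof.
move=> leG; have pM2 := maxover_2group leG.
have sylMM : 2.-Sylow(M) M by rewrite /pHall subxx pM2 indexgg.
have ntM : M :!=: 1.
  by apply: contraNneq ntx => M1; rewrite -in_set1 -[[set 1]]/(1 : {set gT}) -M1.
have sylM := maxover_Sylow sylMM ntM.
have nabM := maxover_Sylow_nonabelian leG sylMM ntM.
have [|lt2] := leqP (logn 2 #|M|) 2; first by move/(p2group_abelian pM2); rewrite (negPf nabM).
have [n oM] := p_natP pM2.
rewrite oM pfactorK // leq_eqVlt in lt2; case/orP: lt2 => [/eqP n3 | n4].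
  by case: (maxover_card_neq8 sylM _ nabM); rewrite oM -n3.
have dv : 16 %| #|G|.
  by rewrite (dvdn_trans _ (cardSg sMG)) // oM (dvdn_exp2l 2 n4).
have := order_16dvd_le336 leG; rewrite dv -[_ == 0]negbK -lt0n cardG_gt0 /=.
case/or3P=> [le2 | /eqP | /eqP]; [|by left|by right].
by case/negP: nsolG; apply: Burnside_p_a_q_b.
Qed.

End MaximalNilpotent.

(** * Groups with p + 1 Sylow p-subgroups *)

Section SylowCoordinates.

Variables (gT : finGroupType) (G Q R : {group gT}) (p : nat) (u : gT).
Implicit Types (S : {group gT}) (d : gT).

Hypotheses (pr_p : prime p) (nSyl : #|'Syl_p(G)| = p.+1).
Hypotheses (sylQ : p.-Sylow(G) Q) (sylR : p.-Sylow(G) R) (neqQR : R != Q).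
Hypotheses (defQ : Q :=: <[u]>) (ou : #[u] = p).
Hypothesis faithG :
  forall d, d \in G -> (forall S, p.-Sylow(G) S -> S :^ d = S) -> d = 1.

Let Qu : u \in Q. Proof. by rewrite defQ cycle_id. Qed.
Let Gu : u \in G. Proof. exact: subsetP (pHall_sub sylQ) _ Qu. Qed.
Let oQ : #|Q| = p. Proof. by rewrite defQ -orderE. Qed.

Lemma Sylow_TI_norm : Q :&: 'N(R) = 1.
Proof.
apply: prime_TIg; first by rewrite oQ.
apply: contra neqQR => nRQ; have sQG := pHall_sub sylQ; have sRG := pHall_sub sylR.
have sylRN : p.-Sylow('N_G(R)) R by rewrite Sylow_subnorm.
have nsR : R <| 'N_G(R) by rewrite normalSG.
have sQR : Q \subset R.
  by rewrite (sub_normal_Hall sylRN nsR) ?(pHall_pgroup sylQ) // subsetI sQG.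
by rewrite eq_sym -val_eqE eqEcard sQR (card_Hall sylQ) (card_Hall sylR) leqnn.
Qed.

Lemma conj_expg_inj i j : R :^ (u ^+ i) = R :^ (u ^+ j) -> i = j %[mod p].
Proof.
move=> eqR; apply/eqP; rewrite -ou -eq_expg_mod_order eq_mulgV1.
rewrite -in_set1 -[[set 1]]/(1 : {set gT}) -Sylow_TI_norm inE.
rewrite groupM ?groupV ?groupX //= inE conjsgM eqR -conjsgM mulgV conjsg1.
exact: subxx.
Qed.

Lemma conj_expg_neq i : R :^ (u ^+ i) <> Q.
Proof.
move=> eqR; case/eqP: neqQR; apply/val_inj => /=.
rewrite -(conjsgK (u ^+ i) R) eqR conjGid //.
by rewrite groupV groupX.
Qed.

(** [Q] has order [p] and meets the normaliser of [R] trivially, so it permutes the [p] Sylow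
    subgroups other than [Q] regularly. *)
Lemma Sylow_coordP S :
  p.-Sylow(G) S -> S :!=: Q -> exists2 i, i < p & S :=: R :^ (u ^+ i).
Proof.
move=> sylS neqS.
have eqO : orbit 'JG Q R = 'Syl_p(G) :\ Q.
  apply/eqP; rewrite eqEcard; apply/andP; split.
    apply/subsetP=> _ /orbitP[q Qq <-]; rewrite !inE pHallJ ?(subsetP (pHall_sub sylQ)) //.
    rewrite sylR andbT; move: Qq; rewrite defQ => /cycleP[i ->].
    by apply/eqP=> /(congr1 (@gval gT)); apply: conj_expg_neq.
  have := cardsD1 Q 'Syl_p(G); rewrite inE sylQ nSyl add1n => [[<-]].
  rewrite card_orbit astab1JG Sylow_TI_norm indexg1 oQ //.
have : S \in orbit 'JG Q R by rewrite eqO !inE sylS andbT.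
case/orbitP=> q; rewrite defQ => /cyclePmin[i]; rewrite ou => lti -> <-.
by exists i.
Qed.

(** Such a [d] fixes [Q] and every [R :^ (u ^+ i)], that is, all Sylow subgroups. *)
Lemma Sylow_fix_cent d :
  d \in G -> commute d u -> R :^ d = R -> d = 1.
Proof.
move=> Gd cdu nRd; apply: faithG => // S sylS.
have [-> | /(Sylow_coordP sylS)[i _ ->]] := eqVneq (S : {set gT}) Q.
  by rewrite defQ -cycleJ (conjg_fixP _) //; apply/commgP/commute_sym.
by rewrite -conjsgM -(commuteX i cdu) conjsgM nRd.
Qed.

Lemma Sylow_norm_fix g : g \in 'N_G(Q) ->
  exists2 i, i < p & R :^ (g * (u ^+ i)^-1) = R.
Proof.
case/setIP=> Gg Ng; have sylRg : p.-Sylow(G) (R :^ g) by rewrite pHallJ.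
have [|i lti /= eqR] := Sylow_coordP (S := (R :^ g)%G) sylRg.
  by apply: contra neqQR => /eqP/= eqR; rewrite -val_eqE /= -(conjsgK g R) eqR
    (normP _) ?groupV.
by exists i => //; rewrite conjsgM eqR conjsgK.
Qed.

Lemma Sylow_cent_gen : 'C_G[u] = Q.
Proof.
apply/eqP; rewrite eqEsubset; apply/andP; split; last first.
  by rewrite subsetI (pHall_sub sylQ) sub_cent1 defQ cent_cycle cent1id.
apply/subsetP=> c /setIP[Gc /cent1P cuc].
have [|i _ fix_i] := @Sylow_norm_fix c.
  rewrite inE Gc; apply: (subsetP (cent_sub Q)).
  by rewrite defQ cent_cycle; apply/cent1P.
have : c * (u ^+ i)^-1 = 1.
  apply: Sylow_fix_cent fix_i; first by rewrite groupM // groupV groupX.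
  apply/commute_sym/commuteM; first exact/commute_sym.
  exact/commuteV/commuteX.
by move/eqP; rewrite -eq_mulgV1 => /eqP->; apply: groupX.
Qed.

(** As the class has fewer than [p] elements, this caps [#|G|] at (p + 1) p (p - 1): 240 is too
    large for [p] = 5, and 336 is attained for [p] = 7. *)
Lemma card_class_norm : #|G| = (p.+1 * p * #|u ^: 'N_G(Q)|)%N.
Proof.
rewrite -nSyl (card_Syl sylQ) -index_cent1.
have <- : #|'C_('N_G(Q))[u]| = p.
  have nsQ : Q \subset 'N_G(Q) by rewrite subsetI (pHall_sub sylQ) normG.
  by rewrite -setIA [_ :&: 'C[u]]setIC setIA Sylow_cent_gen (setIidPl (normG _)).
by rewrite -mulnA Lagrange ?subsetIl // mulnC Lagrange ?subsetIl.
Qed.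

Lemma class_norm_sub : u ^: 'N_G(Q) \subset Q :\ 1.
Proof.
apply/subsetP=> _ /imsetP[g /setIP[_ Ng] ->].
rewrite !inE conjg_eq1 memJ_norm // Qu andbT -cycle_eq1 -defQ.
by rewrite -cardG_gt1 oQ prime_gt1.
Qed.

Lemma card_class_norm_lt : #|u ^: 'N_G(Q)| < p.
Proof.
apply: leq_ltn_trans (subset_leq_card class_norm_sub) _.
by rewrite -oQ [#|Q|](cardsD1 1) group1.
Qed.

End SylowCoordinates.

(** * Generators of a group of order 336 with eight Sylow 7-subgroups *)

Section Order336.

Variables (gT : finGroupType) (G Q R : {group gT}) (u : gT).

Hypotheses (oG : #|G| = 336) (nSyl : #|'Syl_7(G)| = 8).
Hypotheses (sylQ : 7.-Sylow(G) Q) (sylR : 7.-Sylow(G) R) (neqQR : R != Q).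
Hypotheses (defQ : Q :=: <[u]>) (ou : #[u] = 7).
Hypothesis faithG :
  forall d, d \in G -> (forall S : {group gT}, 7.-Sylow(G) S -> S :^ d = S) -> d = 1.

Let pr7 : prime 7. Proof. by []. Qed.
Let Qu : u \in Q. Proof. by rewrite defQ cycle_id. Qed.
Let Gu : u \in G. Proof. exact: subsetP (pHall_sub sylQ) _ Qu. Qed.
Let oQ : #|Q| = 7. Proof. by rewrite defQ -orderE. Qed.

Let coordP := Sylow_coordP pr7 nSyl sylQ sylR neqQR defQ ou.
Let fix_cent := Sylow_fix_cent pr7 nSyl sylQ sylR neqQR defQ ou faithG.
Let norm_fix := Sylow_norm_fix pr7 nSyl sylQ sylR neqQR defQ ou.
Let coord_inj := conj_expg_inj pr7 sylQ sylR neqQR defQ ou.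
Let coord_neq := conj_expg_neq neqQR defQ.

Let expu i j : i = j %[mod 7] -> u ^+ i = u ^+ j.
Proof. by move=> eqij; apply/eqP; rewrite eq_expg_mod_order ou eqij. Qed.

(** Since 336 = 8 * 7 * 6, the class has all six possible elements. *)
Let class_norm : u ^: 'N_G(Q) = Q :\ 1.
Proof.
apply/eqP; rewrite eqEcard (class_norm_sub G pr7 defQ ou) /=.
have /eqP := cardsD1 1 Q; rewrite group1 oQ eqSS => /eqP <-.
have := card_class_norm pr7 nSyl sylQ sylR neqQR defQ ou faithG.
by rewrite oG => /eqP; case: #|_| => [|[|[|[|[|[|[|]]]]]]].
Qed.

(* As 3 is a primitive root mod 7, v generates the stabiliser of Q and R. *)
Lemma ex_norm_cube : exists2 v, v \in G & [/\ Q :^ v = Q, R :^ v = R & u ^ v = u ^+ 3].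
Proof.
have : u ^+ 3 \in u ^: 'N_G(Q).
  by rewrite class_norm !inE groupX // -order_dvdn ou.
case/imsetP=> g Ng u3; have [i _ fixR] := norm_fix Ng.
have /setIP[Gg nQg] := Ng.
exists (g * (u ^+ i)^-1); first by rewrite groupM ?groupV ?groupX.
split=> //; first by rewrite conjsgM (normP nQg) conjGid // groupV groupX.
rewrite conjgM -u3; apply/conjg_fixP/commgP/commuteV/commute_sym.
exact/commuteX2.
Qed.

Variable v : gT.
Hypotheses (Gv : v \in G) (Qv : Q :^ v = Q) (Rv : R :^ v = R) (uv : u ^ v = u ^+ 3).

Let uvX k : u ^ (v ^+ k) = u ^+ (3 ^ k).
Proof.
elim: k => [|k IHk]; first by rewrite expg0 conjg1 expg1.
by rewrite expgSr conjgM IHk conjXg uv -expgM mulnC expnSr mulnC.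
Qed.

Let RvX k : R :^ (v ^+ k) = R.
Proof. by elim: k => [|k IHk]; rewrite ?conjsg1 // expgS conjsgM Rv. Qed.

Let coordvX i k : (R :^ (u ^+ i)) :^ (v ^+ k) = R :^ (u ^+ (i * 3 ^ k)).
Proof. by rewrite -conjsgM conjgC conjsgM RvX conjXg uvX -expgM mulnC. Qed.

Let expv6 : v ^+ 6 = 1.
Proof.
apply: fix_cent (RvX 6); first exact: groupX.
by apply/commute_sym/commgP/conjg_fixP; rewrite uvX -[RHS]expg1; apply: expu.
Qed.

Let expv_eq1 k : v ^+ k = 1 -> (3 ^ k = 1 %[mod 7])%N.
Proof.
move=> vk1; apply/eqP; rewrite -ou -eq_expg_mod_order expg1 -uvX vk1 conjg1.
exact: eqxx.
Qed.

Let exp3_surj j : j != 0 -> j < 7 -> exists2 k, k < 6 & (3 ^ k = j %[mod 7])%N.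
Proof.
case: j => [|[|[|[|[|[|[|]]]]]]] // _ _;
  [by exists 0|by exists 2|by exists 1%N|by exists 4|by exists 5|by exists 3].
Qed.

(** [d] raises [u] to some power [j], and [j] is 3 ^ k modulo 7; the quotient of [d] by [v ^+ k]
    centralises [u] and fixes [R]. *)
Let stab2P d : d \in G -> Q :^ d = Q -> R :^ d = R -> exists2 k, k < 6 & d = v ^+ k.
Proof.
move=> Gd Qd Rd; have : u ^ d \in u ^: 'N_G(Q).
  by apply: imset_f; rewrite inE Gd inE Qd subxx.
rewrite class_norm !inE defQ => /andP[nt1 /cyclePmin[j]]; rewrite ou => ltj uj.
have [|k ltk eqk] := exp3_surj _ ltj; first by apply: contraNneq nt1 => j0; rewrite uj j0.
exists k => //; apply/eqP; rewrite eq_mulgV1; apply/eqP/fix_cent.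
- by rewrite groupM ?groupV ?groupX.
- apply/commute_sym/commgP/conjg_fixP; rewrite conjgM uj -(expu eqk) -uvX.
  by rewrite conjgK.
by rewrite conjsgM Rd -{1}(RvX k) conjsgK.
Qed.

(** With [Q], [R], [R :^ u] as infinity, 0, 1, this produces the map 1 / t. An element taking [R] to
    [Q] is corrected by a translation, a power of [u], to send [Q] to [R], then by a homothety, a
    power of [v], to fix 1. *)
Lemma ex_swap : exists2 w, w \in G & [/\ R :^ w = Q, Q :^ w = R & (R :^ u) :^ w = R :^ u].
Proof.
have [g Gg defQg] := Sylow_trans sylR sylQ.
have sylQg : 7.-Sylow(G) (Q :^ g) by rewrite pHallJ.
have [|i _ /= eqQg] := coordP (S := (Q :^ g)%G) sylQg.
  by apply: contra neqQR => /eqP eqQ; rewrite -val_eqE /= -(inj_eq (@conjsg_inj _ g)) eqQ -defQg.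
pose w := g * (u ^+ i)^-1; have Gw : w \in G by rewrite groupM ?groupV ?groupX.
have Rw : R :^ w = Q by rewrite conjsgM -defQg conjGid // groupV groupX.
have Qw : Q :^ w = R by rewrite conjsgM eqQg conjsgK.
have sylRuw : 7.-Sylow(G) ((R :^ u) :^ w) by rewrite !pHallJ.
have [|j ltj /= eqj] := coordP (S := ((R :^ u) :^ w)%G) sylRuw.
  apply/eqP; rewrite /= -Rw => /conjsg_inj Ru.
  by have := coord_inj (i := 1%N) (j := 0); rewrite expg1 conjsg1 Ru => /(_ erefl).
have [|k _ eqk] := exp3_surj _ ltj.
  apply/eqP=> j0; move: eqj; rewrite j0 conjsg1 -{2}Qw => /conjsg_inj.
  exact: (coord_neq (i := 1%N)).
exists (w * (v ^+ k)^-1); first by rewrite groupM ?groupV ?groupX.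
have QvX m : Q :^ (v ^+ m) = Q.
  by elim: m => [|m IHm]; rewrite ?conjsg1 // expgS conjsgM Qv.
split; rewrite conjsgM.
- by rewrite Rw -{1}(QvX k) conjsgK.
- by rewrite Qw -{1}(RvX k) conjsgK.
by rewrite eqj -(expu eqk) -[(3 ^ k)%N]mul1n -coordvX conjsgK.
Qed.

Variable w : gT.
Hypotheses (Gw : w \in G) (Rw : R :^ w = Q) (Qw : Q :^ w = R).
Hypothesis Ruw : (R :^ u) :^ w = R :^ u.

(** [w] swaps [Q] and [R], so it normalises their common stabiliser. The exponents kept are those
    prime to the order 6 of [v]. *)
Let conj_wP : exists2 k, (k == 1%N) || (k == 5) & v ^ w = v ^+ k.
Proof.
have fixw (A B : {group gT}) : A :^ w = B -> A :^ v = A -> B :^ (v ^ w) = B.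
  by move=> <- Av; rewrite -conjsgM -conjgC conjsgM Av.
have [k ltk eqk] := stab2P (groupJ Gv Gw) (fixw _ _ Rw Rv) (fixw _ _ Qw Qv).
exists k => //.
have ntX m : (3 ^ m != 1 %[mod 7])%N -> v ^+ (k * m) != 1.
  apply: contraNneq; rewrite expgM -eqk -conjXg => /eqP; rewrite conjg_eq1 => /eqP.
  by move/expv_eq1->.
have := ntX 2 isT; have := ntX 3 isT.
case: k ltk {eqk ntX} => [|[|[|[|[|[|]]]]]] // _; rewrite ?expg0 ?eqxx //.
- by rewrite expv6 eqxx.
- by rewrite expv6 eqxx.
by rewrite (expgM v 6 2) expv6 expg1n eqxx.
Qed.

Let swap_coord k i : v ^ w = v ^+ k ->
  (R :^ (u ^+ (3 ^ i))) :^ w = R :^ (u ^+ (3 ^ (k * i))).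
Proof.
move=> vw; rewrite -[(3 ^ i)%N]mul1n -coordvX -conjsgM conjgC conjsgM expg1.
by rewrite Ruw conjXg vw -expgM -{1}[u]expg1 coordvX mul1n.
Qed.

(* An element fixing three of the eight Sylow subgroups is trivial; if w
   centralised v it would fix 6 of them. *)
Lemma swap_inverts i : (R :^ (u ^+ (3 ^ i))) :^ w = R :^ (u ^+ (3 ^ (5 * i))).
Proof.
have [k /orP[]/eqP-> eqk] := conj_wP; last exact: swap_coord.
have fixw j : j != 0 -> j < 7 -> (R :^ (u ^+ j)) :^ w = R :^ (u ^+ j).
  move=> nzj ltj; have [m _ eqm] := exp3_surj nzj ltj.
  by rewrite -(expu eqm) (swap_coord _ eqk) mul1n.
(* In the case [v ^ w = v], [w] fixes every nonzero coordinate. Then [h] sends coordinates 1, 2, 3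
   to infinity, 0, 1, so [w ^ h] fixes these last three points. *)
pose h := u^-1 * w * u^-1.
have Gh : h \in G by rewrite !groupM ?groupV.
have conjw S T : S :^ w = S -> S :^ h = T -> T :^ (w ^ h) = T.
  by move=> Sw <-; rewrite -conjsgM -conjgC conjsgM Sw.
have shift j : (R :^ (u ^+ j.+1)) :^ u^-1 = R :^ (u ^+ j).
  by rewrite expgSr conjsgM conjsgK.
have hE S : S :^ h = ((S :^ u^-1) :^ w) :^ u^-1 by rewrite /h conjsgM [S :^ (_ * _)]conjsgM.
have QuV : Q :^ u^-1 = Q by rewrite conjGid ?groupV.
have h1 : (R :^ (u ^+ 1)) :^ h = Q.
  by rewrite hE (shift 0) conjsg1 Rw QuV.
have h2 : (R :^ (u ^+ 2)) :^ h = R.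
  by rewrite hE (shift 1%N) fixw // (shift 0) conjsg1.
have h3 : (R :^ (u ^+ 3)) :^ h = R :^ (u ^+ 1).
  by rewrite hE (shift 2) fixw // (shift 1%N).
have Qwh := conjw _ _ (fixw 1%N isT isT) h1.
have Rwh := conjw _ _ (fixw 2 isT isT) h2.
have Rwuh := conjw _ _ (fixw 3 isT isT) h3.
have [m _ eqwh] := stab2P (groupJ Gw Gh) Qwh Rwh.
rewrite eqwh coordvX mul1n in Rwuh.
have vm1 : v ^+ m = 1.
  apply: fix_cent (RvX m); first exact: groupX.
  apply/commute_sym/commgP/conjg_fixP.
  by rewrite uvX -[RHS]expg1; apply/expu/coord_inj.
case/eqP: neqQR; apply/val_inj=> /=.
rewrite -Rw; suff -> : w = 1 by rewrite conjsg1.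
by apply: (@conjg_inj _ h); rewrite eqwh vm1 conj1g.
Qed.

(** [u] and [w] already act transitively on the Sylow subgroups, [u] moves the points other than [Q]
    transitively, and the stabiliser of [Q] and [R] consists of powers of [v]. *)
Lemma swap_generates : G :=: <<[set u; v; w]>>.
Proof.
pose H := <<[set u; v; w]>>%G.
have [Hu Hv Hw] : [/\ u \in H, v \in H & w \in H].
  by split; apply: mem_gen; rewrite !inE eqxx ?orbT.
apply/eqP; rewrite eqEsubset gen_subG andbC; apply/andP; split.
  by apply/subsetP=> y; rewrite !inE => /orP[/orP[]|] /eqP->.
apply/subsetP=> g Gg.
have sylQg : 7.-Sylow(G) (Q :^ g) by rewrite pHallJ.
have [h Hh Qg] : exists2 h, h \in H & Q :^ g = Q :^ h.
  have [Qg | /(coordP sylQg)[i _ /= ->]] := eqVneq (Q :^ g) Q.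
    by exists 1; rewrite ?group1 // conjsg1.
  by exists (w * u ^+ i); rewrite ?groupM ?groupX // conjsgM Qw.
have Gh : h \in G by apply: (subsetP _ h Hh); rewrite gen_subG; apply/subsetP=> y;
  rewrite !inE => /orP[/orP[]|] /eqP->.
have [|i _ fixR] := norm_fix (g := g * h^-1).
  rewrite inE groupM ?groupV //=; apply/normP.
  by rewrite conjsgM Qg conjsgK.
have [||k _ eqk] := stab2P _ _ fixR.
- by rewrite !groupM ?groupV ?groupX.
- by rewrite !conjsgM Qg conjsgK conjGid // groupV groupX.
rewrite -(mulgKV h g) -(mulgKV (u ^+ i) (g * h^-1)) eqk.
by rewrite !groupM ?groupX.
Qed.

End Order336.

(** * Moebius transformations *)

Section Mobius.

Variable F : finFieldType.
Local Open Scope ring_scope.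
Implicit Types (A B : {'GL_2[F]}) (t : option F) (v : F * F).

Lemma big_I2 (f : 'I_2 -> F) : \sum_k f k = f 0 + f 1.
Proof.
by rewrite !big_ord_recl big_ord0 addr0; congr (f _ + f _); apply: val_inj.
Qed.

Definition homog t : F * F := if t is Some a then (a, 1) else (1, 0).

(** [None] is the point at infinity. The zero vector also lands there, but invertible matrices never
    produce it from a point. *)
Definition dehomog v : option F := if v.2 == 0 then None else Some (v.1 / v.2).

Definition rowact A v : F * F :=
  (v.1 * GLval A 0 0 + v.2 * GLval A 1 0, v.1 * GLval A 0 1 + v.2 * GLval A 1 1).

(* GL_2 acts on row vectors from the right, matching the product of permutations. *)
Definition mobius_fun A t := dehomog (rowact A (homog t)).

Lemma rowact1 v : rowact 1%g v = v.
Proof. by case: v => a b; rewrite /rowact GL_1E !mxE /= !mulr1 !mulr0 addr0 add0r. Qed.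

Lemma rowactM A B v : rowact (A * B)%g v = rowact B (rowact A v).
Proof.
by rewrite /rowact GL_MxE !mxE !big_I2 /=; congr (_, _); ring.
Qed.

Lemma rowactZ A v c :
  rowact A (c * v.1, c * v.2) = (c * (rowact A v).1, c * (rowact A v).2).
Proof. by rewrite /rowact /=; congr (_, _); ring. Qed.

Lemma rowact_eq0 A v : (rowact A v == (0, 0)) = (v == (0, 0)).
Proof.
have act0 B : rowact B (0, 0) = (0, 0) by rewrite /rowact /= !mul0r !addr0.
apply/eqP/eqP=> [Av0 | ->]; last exact: act0.
by rewrite -(rowact1 v) -(mulgV A) rowactM Av0 act0.
Qed.

Lemma dehomogZ v c : c != 0 -> dehomog (c * v.1, c * v.2) = dehomog v.
Proof.
move=> nz_c; rewrite /dehomog /= mulf_eq0 (negPf nz_c) /=.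
by case: eqP => // /eqP nz_v; rewrite -mulf_div divff // mul1r.
Qed.

Lemma homogK : cancel homog dehomog.
Proof. by case=> [a|]; rewrite /dehomog /= ?eqxx // oner_eq0 divr1. Qed.

Lemma homog_neq0 t : homog t != (0, 0).
Proof. by case: t => [a|] /=; rewrite -pair_eqE /pair_eq /= oner_eq0 ?andbF. Qed.

Lemma dehomogK v : v != (0, 0) ->
  exists2 c, c != 0 & homog (dehomog v) = (c * v.1, c * v.2).
Proof.
case: v => a b; rewrite -pair_eqE /pair_eq /dehomog /=.
have [-> /= | nz_b _] := eqVneq b 0.
  rewrite andbT => nz_a; exists a^-1; first by rewrite invr_eq0.
  by rewrite mulVf // mulr0.
by exists b^-1; rewrite ?invr_eq0 //= mulVf // mulrC.
Qed.

Lemma mobius_funM A B t : mobius_fun (A * B)%g t = mobius_fun B (mobius_fun A t).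
Proof.
rewrite /mobius_fun rowactM.
have [|c nz_c ->] := @dehomogK (rowact A (homog t)).
  by rewrite rowact_eq0 homog_neq0.
by rewrite rowactZ dehomogZ.
Qed.

Lemma mobius_fun1 t : mobius_fun 1%g t = t.
Proof. by rewrite /mobius_fun rowact1 homogK. Qed.

Lemma mobius_fun_inj A : injective (mobius_fun A).
Proof.
apply: (can_inj (g := mobius_fun A^-1%g)) => t.
by rewrite -mobius_funM mulgV mobius_fun1.
Qed.

Definition mobius A : {perm option F} := perm (@mobius_fun_inj A).

Lemma mobiusE A t : mobius A t = mobius_fun A t.
Proof. exact: permE. Qed.

Lemma mobius_mulg A B : mobius (A * B)%g = (mobius A * mobius B)%g.
Proof. by apply/permP=> t; rewrite permM !mobiusE mobius_funM. Qed.

Lemma mobiusM : {in setT &, {morph mobius : A B / (A * B)%g}}.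
Proof. by move=> A B _ _; apply: mobius_mulg. Qed.
Canonical mobius_morphism := @Morphism _ _ setT mobius mobiusM.

Definition mx2 (a b c d : F) : 'M[F]_2 := \matrix_(i, j)
  if i == 0 then if j == 0 then a else b else if j == 0 then c else d.

Lemma eq_mx2 (M N : 'M[F]_2) :
    M 0 0 = N 0 0 -> M 0 1 = N 0 1 -> M 1 0 = N 1 0 -> M 1 1 = N 1 1 ->
  M = N.
Proof.
move=> e00 e01 e10 e11; apply/matrixP=> i j.
have I2 (k : 'I_2) : k = 0 \/ k = 1.
  by case: k => [[|[|k]]] //= ltk; [left | right]; apply: val_inj.
by case: (I2 i) => ->; case: (I2 j) => ->.
Qed.

(** Singular entries yield the identity, whence the determinant hypotheses in what follows. *)
Definition gl2 (a b c d : F) : {'GL_2[F]} := insubd (1%g : {'GL_2[F]}) (mx2 a b c d).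

Lemma det_mx2 (M : 'M[F]_2) : \det M = M 0 0 * M 1 1 - M 0 1 * M 1 0.
Proof.
rewrite (expand_det_row _ 0) big_I2 /cofactor !det_mx11 !mxE.
have -> : lift (0 : 'I_2) (0 : 'I_1) = 1 by apply: val_inj.
have -> : lift (1 : 'I_2) (0 : 'I_1) = 0 by apply: val_inj.
by rewrite /= expr0 expr1; ring.
Qed.

Lemma gl2E a b c d : a * d - b * c != 0 -> GLval (gl2 a b c d) = mx2 a b c d.
Proof.
move=> nz_det; have U : mx2 a b c d \is a GRing.unit.
  by rewrite -[_ \is a _]/(_ \in unitmx) unitmxE unitfE det_mx2 !mxE.
exact: (insubdK (1%g : {'GL_2[F]}) U).
Qed.

Lemma mobius_gl2 a b c d t : a * d - b * c != 0 ->
  mobius (gl2 a b c d) t =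
    dehomog (if t is Some y then (y * a + c, y * b + d) else (a, b)).
Proof.
move=> nz_det; rewrite mobiusE /mobius_fun /rowact gl2E // !mxE /=.
by case: t => [y|] /=; rewrite !mul1r ?mul0r ?addr0.
Qed.

Lemma dehomog1 y : dehomog (y, 1) = Some y.
Proof. by rewrite -[RHS]homogK. Qed.

Lemma mobius_scale A B c :
  GLval A = c *: GLval B -> mobius A = mobius B.
Proof.
move=> defA; have nz_c : c != 0.
  apply: contraNneq (GL_det A) => c0.
  by rewrite defA c0 scale0r det0.
apply/permP=> t; rewrite !mobiusE /mobius_fun -(dehomogZ (rowact B _) nz_c).
by congr (dehomog _); rewrite /rowact defA !mxE /=; congr (_, _); ring.
Qed.

(** Fixing infinity and 0 kills the off-diagonal entries; fixing 1 then equates the diagonal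
    ones. *)
Lemma mobius_eq1 A : mobius A = 1%g -> GLval A = (GLval A 0 0)%:M.
Proof.
move=> A1; have fixA t : dehomog (rowact A (homog t)) = t.
  by rewrite -[LHS]mobiusE A1 perm1.
have A01 : GLval A 0 1 = 0.
  have := fixA None; rewrite /dehomog /rowact /= !mul1r !mul0r !addr0.
  by case: eqP.
have A10 : GLval A 1 0 = 0.
  have := fixA (Some 0); rewrite /dehomog /rowact /= !mul1r !mul0r !add0r.
  case: eqP => // /eqP nz [] /eqP; rewrite mulf_eq0 invr_eq0 (negPf nz) orbF.
  by move/eqP.
have A11 : GLval A 1 1 = GLval A 0 0.
  have := fixA (Some 1); rewrite /dehomog /rowact /= !mul1r A01 A10 addr0 add0r.
  by case: eqP => // /eqP nz [] /divr1_eq->.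
by apply: eq_mx2; rewrite !mxE ?mulr1n ?mulr0n.
Qed.

Lemma mobius1 : mobius 1%g = 1%g.
Proof. by apply/permP=> t; rewrite mobiusE mobius_fun1 perm1. Qed.

Lemma mobius_eqP A B : mobius A = mobius B -> exists c, GLval A = c *: GLval B.
Proof.
move=> eqAB; have AB1 : mobius (A * B^-1)%g = 1%g.
  have -> : mobius (A * B^-1)%g = mobius (B * B^-1)%g.
    by apply/permP=> t; move/permP/(_ t): eqAB; rewrite !mobiusE !mobius_funM => ->.
  by rewrite (mulgV B) mobius1.
have defAB := mobius_eq1 AB1; exists (GLval (A * B^-1)%g 0 0).
rewrite -mul_scalar_mx -defAB.
by rewrite -GL_MxE mulgKV.
Qed.

Definition scalar_gl2 (a : F) := gl2 a 0 0 a.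

Lemma scalar_gl2E a : a != 0 -> GLval (scalar_gl2 a) = a%:M.
Proof.
move=> nz_a; rewrite gl2E; last by rewrite mulr0 subr0 mulf_neq0.
by apply: eq_mx2; rewrite !mxE ?mulr1n ?mulr0n.
Qed.

Lemma card_ker_mobius : #|'ker mobius| = #|F|.-1.
Proof.
have inj : {in [set~ 0] &, injective scalar_gl2}.
  move=> a b; rewrite !inE => nza nzb /(congr1 (fun A => GLval A 0 0)).
  by rewrite !scalar_gl2E // !mxE.
rewrite -(cardsC1 (0 : F)) -(card_in_imset inj); congr #|pred_of_set _|.
apply/setP=> A; apply/idP/imsetP=> [kerA | [a /[!inE] nz_a ->] /=]; last first.
  rewrite (@mobius_scale _ 1%g a) ?mobius1 ?eqxx //.
  by rewrite scalar_gl2E // GL_1E scalemx1.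
have defA := mobius_eq1 (mker kerA); exists (GLval A 0 0); last first.
  apply: val_inj; rewrite /= -[RHS]/(GLval _) scalar_gl2E //.
  by apply: contraNneq (GL_det A) => a0; rewrite defA a0 det_scalar expr0n.
by rewrite !inE; apply: contraNneq (GL_det A) => a0; rewrite defA a0 det_scalar expr0n.
Qed.

Lemma card_mobius : #|mobius @* setT| = (#|F| * #|F|.-1 * #|F|.+1)%N.
Proof.
have F1 : (0 < #|F|.-1)%N.
  by rewrite -(cardsC1 (0 : F)) card_gt0; apply/set0Pn; exists 1; rewrite !inE oner_eq0.
have : #|'GL_2[F]| = (#|'ker mobius| * #|mobius @* setT|)%N.
  by rewrite card_morphim setIid mulnC -divgS ?subsetT // divnK ?cardSg ?subsetT.
rewrite card_GL_2 card_ker_mobius => /esym oGL.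
by apply/eqP; rewrite -(eqn_pmul2l F1) oGL; apply/eqP; ring.
Qed.

Lemma ker_mobius_SL : 'ker_(SL 2 F) mobius \subset 'Z(SL 2 F).
Proof.
rewrite subsetI subsetIl; apply/subsetP=> A /setIP[_ /mker kerA].
have defA := mobius_eq1 kerA.
apply/centP=> B _; apply: val_inj.
by rewrite -[LHS]/(GLval A *m GLval B) -[RHS]/(GLval B *m GLval A) defA scalar_mxC.
Qed.

(** The hypothesis avoids computing the centre of SL: a central matrix has central, hence trivial,
    image, so the centre is exactly the kernel. *)
Lemma isog_PSL2_mobius : 'Z(mobius @* SL 2 F) = 1%g -> PSL 2 F \isog mobius @* SL 2 F.
Proof.
move=> Z1; have defZ : 'Z(SL 2 F) = 'ker_(SL 2 F) mobius.
  apply/eqP; rewrite eqEsubset ker_mobius_SL andbT subsetI center_sub /=.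
  apply/subsetP=> A /setIP[SLA cA]; rewrite !inE /= -in_set1.
  have : mobius A \in 'Z(mobius @* SL 2 F).
    apply/setIP; split; first by apply: mem_morphim => //; apply: in_setT.
    apply/centP=> _ /morphimP[B _ SLB ->].
    by rewrite /= /commute -!mobius_mulg (centP cA).
  by rewrite Z1.
by rewrite /PSL /= defZ; apply: (first_isog_loc mobius_morphism (subsetT (SL 2 F))).
Qed.

End Mobius.

(** * Orders 240 and 336 *)

Fact Sylow5_numbers n : n < 241 ->
  if n %| 240 then if n %% 5 == 1%N then (n != 1%N) ==> (n \in [:: 6; 16])
  else true else true.
Proof. by move: n; apply: all_iotaP; vm_compute. Qed.

Fact Sylow7_numbers n : n < 337 ->
  if n %| 336 then if n %% 7 == 1%N then (n != 1%N) ==> (n == 8)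
  else true else true.
Proof. by move: n; apply: all_iotaP; vm_compute. Qed.

Section SylowCounting.

Variables (gT : finGroupType) (G : {group gT}) (x : gT).
Implicit Types (H M N C P K Q R S : {group gT}) (p : nat).

Hypotheses (Gx : x \in G) (nsolG : ~~ solvable G).
Hypothesis nilH : forall H, x \in H -> H \proper G -> nilpotent H.
Hypothesis radG : forall N, N <| G -> solvable N -> N :=: 1.
Hypothesis p2x : 2.-elt x.

(** [G / N] is generated by the image of the 2-element [x], so it is a 2-group. *)
Lemma odd_pgroup_sub_normal N S p :
  N <| G -> N :!=: 1 -> odd p -> S \subset G -> p.-group S -> S \subset N.
Proof.
move=> nsNG ntN odd_p sSG pS; have nNS := subset_trans sSG (normal_norm nsNG).
have defG := normal_mul_cycle Gx nilH radG nsNG ntN.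
have p2GN : 2.-group (G / N).
  have := quotientMidl N <[x]>; rewrite defG => ->.
  by rewrite quotient_pgroup.
rewrite -quotient_sub1 //; apply/trivgP/card1_trivg.
apply: (@pnat_1 2); first exact: pgroupS (quotientS N sSG) p2GN.
rewrite -[pnat _ _]/(2^'.-group _) (pi_pgroup (quotient_pgroup N pS)) //.
by rewrite !inE; apply: contraTneq odd_p => ->.
Qed.

Lemma card_Syl_neq1 p : prime p -> p %| #|G| -> #|'Syl_p(G)| != 1%N.
Proof.
move=> pr_p dvp; have [S sylS] := Sylow_exists p G.
rewrite (card_Syl sylS) indexg_eq1 subsetI subxx /=; apply/negP=> nSG.
have nsS : S <| G by rewrite /normal (pHall_sub sylS).
have S1 := radG nsS (pgroup_sol (pHall_pgroup sylS)).
have := card_Hall sylS; rewrite S1 cards1 => /esym/eqP.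
by rewrite partG_eq1 pgroupE /= p'natE ?dvp.
Qed.

(** A nontrivial kernel of the action on Sylow subgroups is normal, so it contains [Q]; then [Q]
    would normalise [R]. *)
Lemma Syl_faithful p Q R :
    prime p -> odd p -> p.-Sylow(G) Q -> p.-Sylow(G) R -> R != Q -> #|Q| = p ->
  forall d, d \in G -> (forall S, p.-Sylow(G) S -> S :^ d = S) -> d = 1.
Proof.
move=> pr_p odd_p sylQ sylR neqQR oQ d Gd fixd; apply: contraTeq isT => ntd.
have prQ : prime #|Q| by rewrite oQ.
have [u defQ] := cyclicP (prime_cyclic prQ).
have ou : #[u] = p by rewrite orderE -defQ.
pose N := [group of 'C_G('Syl_p(G) | 'JG)].
have nsN : N <| G.
  rewrite /normal subsetIl normsI ?normG //.
  exact: subset_trans (atrans_acts (Syl_trans p G)) (astab_norm _ _).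
have ntN : N :!=: 1.
  apply: contraNneq ntd => N1; rewrite -in_set1 -[[set 1]]/(1 : {set gT}) -N1.
  rewrite inE Gd; apply/astabP=> S; rewrite inE => sylS.
  by apply: val_inj; apply: fixd.
have sQN := odd_pgroup_sub_normal nsN ntN odd_p (pHall_sub sylQ) (pHall_pgroup sylQ).
have := Sylow_TI_norm pr_p sylQ sylR neqQR defQ ou.
rewrite (setIidPl _); last first.
  apply: subset_trans sQN _; rewrite -astab1JG (subset_trans (subsetIr _ _)) //.
  by rewrite astabS // sub1set inE.
by move=> Q1; have := prime_gt1 prQ; rewrite Q1 cards1 ltnn.
Qed.

(** Six Sylow 5-subgroups would bound [#|G|] by 6 * 5 * 4. With sixteen, the normaliser of [Q] has
    order 15 and centralises [Q], so Burnside gives a normal complement of order 48. *)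
Lemma card_neq240 : #|G| <> 240.
Proof.
move=> oG.
have dv5 : 5 %| #|G| by rewrite oG.
have := card_Syl_neq1 (isT : prime 5) dv5.
have := card_Syl_mod G (isT : prime 5); have := card_Syl_dvd 5 G.
rewrite oG => dvn modn neq1.
have : #|'Syl_5(G)| \in [:: 6; 16].
  have ltn : #|'Syl_5(G)| < 241 by rewrite ltnS dvdn_leq.
  by have := Sylow5_numbers ltn; rewrite dvn modn eqxx neq1.
have [Q sylQ] := Sylow_exists 5 G.
have oQ : #|Q| = 5 by rewrite (card_Hall sylQ) oG p_part.
rewrite !inE => /orP[] /eqP nSyl.
  have [R sylR neqQR] : exists2 R : {group gT}, 5.-Sylow(G) R & R != Q.
    have /subsetPn[R] : ~~ ('Syl_5(G) \subset [set Q]).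
      by apply/negP=> /subset_leq_card; rewrite nSyl cards1.
    by rewrite !inE => sylR neqQR; exists R.
  have prQ : prime #|Q| by rewrite oQ.
  have [u defQ] := cyclicP (prime_cyclic prQ).
  have ou : #[u] = 5 by rewrite orderE -defQ.
  have pr5 : prime 5 by [].
  have faithG := Syl_faithful pr5 isT sylQ sylR neqQR oQ.
  have := card_class_norm_lt G pr5 defQ ou.
  have := card_class_norm pr5 nSyl sylQ sylR neqQR defQ ou faithG.
  by rewrite oG => /eqP; case: #|_| => [|[|[|[|[|]]]]].
have oN : #|'N_G(Q)| = 15.
  apply/eqP; rewrite -(eqn_pmul2l (isT : 0 < 16)) -[X in (X * _)%N]nSyl (card_Syl sylQ).
  by rewrite mulnC Lagrange ?subsetIl // oG.
have [T sylT] := Sylow_exists 3 'N_G(Q).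
have oT : #|T| = 3 by rewrite (card_Hall sylT) /= oN p_part.
have sTN := pHall_sub sylT; have nQT : T \subset 'N(Q) := subset_trans sTN (subsetIr _ _).
(* The number of fixed points of [T] on [Q] divides 5 and is congruent to 5 modulo 3, so it is not
   1. *)
have cQT : T \subset 'C(Q).
  have := pgroup_fix_mod (pHall_pgroup sylT) (_ : [acts T, on Q | 'J]).
  rewrite astabsJ => /(_ nQT); rewrite oQ afixJ => /eqP eqm.
  have dv : #|'C_Q(T)| %| 5 by rewrite -oQ cardSg ?subsetIl.
  rewrite centsC; apply/setIidPl/eqP; rewrite eqEcard subsetIl oQ leqNgt.
  apply/negP=> lt5; move: dv lt5 eqm.
  by case: #|_| => [|[|[|[|[|]]]]].
have cQN : Q \subset 'C('N_G(Q)).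
  have sQN : Q \subset 'N_G(Q) by rewrite subsetI normG (pHall_sub sylQ).
  rewrite centsC; have <- : (Q * T) = 'N_G(Q).
    apply/eqP; rewrite eqEcard mul_subG //= oN TI_cardMg ?oQ ?oT //.
    by apply: coprime_TIg; rewrite oQ oT.
  by rewrite mul_subG // -?abelianE ?cyclic_abelian ?prime_cyclic ?oQ.
have [K [nsKG defG p'K]] := Burnside_normal_complement sylQ cQN.
case/negP: nsolG; apply: (complement_solvable sylQ nsKG defG).
apply: Burnside_p_a_q_b; have := card_complement sylQ defG p'K.
by rewrite oQ oG => /eqP; rewrite -[240]/(48 * 5)%N eqn_pmul2r // => /eqP->.
Qed.

End SylowCounting.

(** * Conjugation on Sylow 7-subgroups as Moebius transformations over F_7 *)

Section SylowMobius.

Variables (gT : finGroupType) (G Q R : {group gT}) (u : gT).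

Hypotheses (oG : #|G| = 336) (nSyl : #|'Syl_7(G)| = 8).
Hypotheses (sylQ : 7.-Sylow(G) Q) (sylR : 7.-Sylow(G) R) (neqQR : R != Q).
Hypotheses (defQ : Q :=: <[u]>) (ou : #[u] = 7).
Hypothesis faithG :
  forall d, d \in G -> (forall S : {group gT}, 7.-Sylow(G) S -> S :^ d = S) -> d = 1.

Let pr7 : prime 7. Proof. by []. Qed.
Let Qu : u \in Q. Proof. by rewrite defQ cycle_id. Qed.
Let Gu : u \in G. Proof. exact: subsetP (pHall_sub sylQ) _ Qu. Qed.

(* The projective line over F_7 labels the Sylow 7-subgroups. *)
Definition Sylow_coord (t : option 'F_7) : {set gT} :=
  if t is Some a then R :^ (u ^+ a) else Q.

Local Notation c := Sylow_coord.

Let coordP := Sylow_coordP pr7 nSyl sylQ sylR neqQR defQ ou.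
Let coord_inj := conj_expg_inj pr7 sylQ sylR neqQR defQ ou.
Let coord_neq := conj_expg_neq neqQR defQ.

Let expu i j : i = j %[mod 7] -> u ^+ i = u ^+ j.
Proof. by move=> eqij; apply/eqP; rewrite eq_expg_mod_order ou eqij. Qed.

Lemma Sylow_coord_inj : injective c.
Proof.
move=> [a|] [b|] //= eqc.
- have := coord_inj eqc; rewrite !modn_small ?(ltn_ord a) ?(ltn_ord b) // => eqab.
  by congr Some; apply: val_inj.
- by case: (coord_neq eqc).
by case: (coord_neq (esym eqc)).
Qed.

Lemma Sylow_coord_Syl t : exists2 S : {group gT}, 7.-Sylow(G) S & c t = S.
Proof.
case: t => [a|]; last by exists Q.
by exists (R :^ (u ^+ a))%G; rewrite // pHallJ ?groupX.
Qed.

Lemma Sylow_coord_surj (S : {group gT}) : 7.-Sylow(G) S -> exists t, c t = S.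
Proof.
move=> sylS; have [eqSQ | /(coordP sylS)[i lti ->]] := eqVneq (S : {set gT}) Q.
  by exists None.
by exists (Some (Ordinal lti : 'F_7)).
Qed.

(** Transports conjugation by [g] to the projective line. For [g] in [G] a suitable permutation
    always exists, so the default [1] is not reached. *)
Definition Sylow_perm g : {perm option 'F_7} :=
  odflt 1 [pick s : {perm option 'F_7} | [forall t, c (s t) == c t :^ g]].

Lemma Sylow_permE g t : g \in G -> c (Sylow_perm g t) = c t :^ g.
Proof.
move=> Gg; rewrite /Sylow_perm; case: pickP => [s /forallP/(_ t)/eqP // | no_s].
have ex_t t' : exists t1, c t1 == c t' :^ g.
  have [S sylS ->] := Sylow_coord_Syl t'.
  have [|t1 eqt1] := @Sylow_coord_surj (S :^ g)%G; first by rewrite pHallJ.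
  by exists t1; apply/eqP.
pose s0 t' := xchoose (ex_t t').
have s0E t' : c (s0 t') = c t' :^ g by apply/eqP/(xchooseP (ex_t t')).
have inj_s0 : injective s0.
  move=> t1 t2 eqs; apply: Sylow_coord_inj; apply: (@conjsg_inj _ g).
  by rewrite -!s0E eqs.
by case/forallP: (no_s (perm inj_s0)) => t'; rewrite permE s0E.
Qed.

Lemma Sylow_permP g (s : {perm option 'F_7}) :
  g \in G -> (forall t, c (s t) = c t :^ g) -> Sylow_perm g = s.
Proof.
by move=> Gg sE; apply/permP=> t; apply: Sylow_coord_inj; rewrite Sylow_permE ?sE.
Qed.

Lemma Sylow_permM : {in G &, {morph Sylow_perm : g h / g * h}}.
Proof.
move=> g h Gg Gh; apply: Sylow_permP => [|t]; first exact: groupM.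
by rewrite permM !Sylow_permE // conjsgM.
Qed.
Canonical Sylow_perm_morphism := Morphism Sylow_permM.

Lemma injm_Sylow_perm : 'injm Sylow_perm.
Proof.
apply/injmP=> g h Gg Gh eqf; apply/eqP; rewrite eq_mulgV1; apply/eqP/faithG.
  by rewrite groupM ?groupV.
move=> S sylS; have [t <-] := Sylow_coord_surj sylS.
by rewrite conjsgM -Sylow_permE // eqf Sylow_permE // conjsgK.
Qed.

Lemma Sylow_perm_shift : Sylow_perm u = mobius (gl2 1%R 0%R 1%R 1%R : {'GL_2['F_7]}).
Proof.
apply: Sylow_permP => // t; rewrite mobius_gl2 //.
case: t => [a|]; rewrite ?mulr1 ?mulr0 ?add0r.
  rewrite dehomog1 /= -conjsgM -expgSr.
  have shift n : ((n + 1) %% 7 = n.+1 %[mod 7])%N by rewrite modn_mod addn1.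
  by congr (_ :^ _); apply: expu; apply: shift.
by rewrite /dehomog /= conjGid.
Qed.

Variables v w : gT.
Hypotheses (Gv : v \in G) (Qv : Q :^ v = Q) (Rv : R :^ v = R) (uv : u ^ v = u ^+ 3).
Hypotheses (Gw : w \in G) (Rw : R :^ w = Q) (Qw : Q :^ w = R).
Hypothesis Ruw : (R :^ u) :^ w = R :^ u.

Lemma Sylow_perm_mul : Sylow_perm v = mobius (gl2 3%R 0%R 0%R 1%R : {'GL_2['F_7]}).
Proof.
apply: Sylow_permP => // t; rewrite mobius_gl2 //.
case: t => [a|]; rewrite ?mulr0 ?addr0 ?add0r; last by rewrite /dehomog /= Qv.
rewrite dehomog1 /= -conjsgM conjgC conjsgM Rv conjXg uv -expgM.
have scale n : ((n * 3) %% 7 = 3 * n %[mod 7])%N by rewrite modn_mod mulnC.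
by congr (_ :^ _); apply: expu; apply: scale.
Qed.

(** 5 is the inverse of 3 modulo 7, so inverse pairs are the pairs of powers 3 ^ k and 5 ^ k. *)
Let Sylow_coord_inv (a b : 'F_7) : (a * b)%R = 1%R ->
  (R :^ (u ^+ a)) :^ w = R :^ (u ^+ b).
Proof.
have swap := swap_inverts oG nSyl sylQ sylR neqQR defQ ou faithG Gv Qv Rv uv Gw Rw Qw Ruw.
have swapE i j k : (i = 3 ^ k %[mod 7])%N -> (j = 5 ^ k %[mod 7])%N ->
    (R :^ (u ^+ i)) :^ w = R :^ (u ^+ j).
  move=> /expu-> eqj; rewrite swap; congr (_ :^ _); apply: expu.
  by rewrite expnM -modnXm.
have inv7 i j : i < 7 -> j < 7 -> ((i * j) %% 7 = 1)%N ->
    exists2 k, (i = 3 ^ k %[mod 7])%N & (j = 5 ^ k %[mod 7])%N.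
  case: i => [|[|[|[|[|[|[|]]]]]]] // _;
  case: j => [|[|[|[|[|[|[|]]]]]]] // _ _;
  [exists 0|exists 2|exists 1%N|exists 4|exists 5|exists 3]; by vm_compute.
move=> /(congr1 val) ab1.
by have [k eqa eqb] := inv7 a b (ltn_ord a) (ltn_ord b) ab1; apply: swapE eqa eqb.
Qed.

Lemma Sylow_perm_swap : Sylow_perm w = mobius (gl2 0%R 1%R 1%R 0%R : {'GL_2['F_7]}).
Proof.
apply: Sylow_permP => // t; rewrite mobius_gl2 //.
case: t => [a|]; rewrite ?mulr1 ?mulr0 ?addr0 ?add0r; last first.
  by rewrite dehomog1 /= conjsg1 Qw.
rewrite /dehomog /=; have [-> | nz_a] := eqVneq a 0%R; first by rewrite /= conjsg1 Rw.
by rewrite mul1r /= (Sylow_coord_inv (divff nz_a)).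
Qed.

(** Inclusion is checked on the generators [u], [v], [w]; equality follows since both sides have
    order 336. *)
Lemma im_Sylow_perm : Sylow_perm @* G = @mobius 'F_7 @* [set: {'GL_2['F_7]}].
Proof.
apply/eqP; rewrite eqEcard; apply/andP; split; last first.
  rewrite (card_injm injm_Sylow_perm (subxx G)) oG card_mobius.
  by rewrite card_Fp.
rewrite sub_morphim_pre //.
have genG := swap_generates oG nSyl sylQ sylR neqQR defQ ou faithG Gv Rv uv Gw Qw.
suff : <<[set u; v; w]>> \subset Sylow_perm @*^-1 (@mobius 'F_7 @* [set: {'GL_2['F_7]}]).
  by rewrite -genG.
have pre g A : g \in G -> Sylow_perm g = mobius A ->
    g \in Sylow_perm @*^-1 (@mobius 'F_7 @* [set: {'GL_2['F_7]}]).
  move=> Gg eqg; rewrite mem_morphpre //= eqg.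
  by apply: mem_morphim => //; apply: in_setT.
rewrite gen_subG; apply/subsetP=> g /setUP[/setUP[]|] /set1P->.
- exact: pre Gu Sylow_perm_shift.
- exact: pre Gv Sylow_perm_mul.
exact: pre Gw Sylow_perm_swap.
Qed.

End SylowMobius.

Lemma ex_mobius_isom (gT : finGroupType) (G Q R : {group gT}) :
    #|G| = 336 -> #|'Syl_7(G)| = 8 ->
    7.-Sylow(G) Q -> 7.-Sylow(G) R -> R != Q -> #|Q| = 7 ->
    (forall d, d \in G ->
       (forall S : {group gT}, 7.-Sylow(G) S -> S :^ d = S) -> d = 1) ->
  exists2 f : {morphism G >-> {perm option 'F_7}},
    'injm f & f @* G = @mobius 'F_7 @* [set: {'GL_2['F_7]}].
Proof.
move=> oG nSyl sylQ sylR neqQR oQ faithG; have prQ : prime #|Q| by rewrite oQ.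
have [u defQ] := cyclicP (prime_cyclic prQ).
have ou : #[u] = 7 by rewrite orderE -defQ.
have [v Gv [Qv Rv uv]] := ex_norm_cube oG nSyl sylQ sylR neqQR defQ ou faithG.
have [w Gw [Rw Qw Ruw]] := ex_swap nSyl sylQ sylR neqQR defQ ou Gv Qv Rv uv.
exists (Sylow_perm_morphism nSyl sylQ sylR neqQR defQ ou).
  exact: injm_Sylow_perm.
by apply: (@im_Sylow_perm _ _ _ _ _ oG nSyl sylQ sylR neqQR defQ ou faithG v w).
Qed.

Lemma SL_normal n (F : finFieldType) : SL n F <| [set: {'GL_n[F]}].
Proof.
rewrite /normal subsetT; apply/subsetP=> A _; rewrite inE.
apply/subsetP=> _ /imsetP[B SLB ->]; move: SLB; rewrite !inE => /eqP detB.
rewrite /conjg !GL_ME !det_mulmx detB GRing.mul1r -det_mulmx -GL_MxE mulVg GL_1E det1.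
exact: eqxx.
Qed.

Section MobiusF7.

Local Notation M7 := (@mobius 'F_7).

Lemma mobius_shift_SL : M7 (gl2 1%R 0%R 1%R 1%R) \in M7 @* SL 2 'F_7.
Proof.
apply: mem_morphim; rewrite ?in_setT // inE gl2E // det_mx2 !mxE.
by [].
Qed.

(* 3 is not a square in F_7. *)
Lemma mobius_scale_notin_SL : M7 (gl2 3%R 0%R 0%R 1%R) \notin M7 @* SL 2 'F_7.
Proof.
apply/negP=> /morphimP[B _ SLB] /= /mobius_eqP[a].
rewrite gl2E // => /(congr1 determinant).
rewrite detZ det_mx2 !mxE /=; move: SLB; rewrite inE => /eqP->.
move=> /(congr1 val); move: a => [[|[|[|[|[|[|[|a]]]]]]] lta] //.
Qed.

End MobiusF7.

(** * The minimal normal subgroup in order 336 *)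

Section PSL27.

Variables (gT : finGroupType) (G : {group gT}) (x : gT).
Implicit Types (H M N C P K Q R S : {group gT}) (p : nat).

Hypothesis Gx : x \in G.
Hypothesis nilH : forall H, x \in H -> H \proper G -> nilpotent H.
Hypothesis radG : forall N, N <| G -> solvable N -> N :=: 1.
Hypothesis p2x : 2.-elt x.
Hypothesis oG : #|G| = 336.

Let sub_normal := odd_pgroup_sub_normal Gx nilH radG p2x.

Let nSyl : #|'Syl_7(G)| = 8.
Proof.
have dv7 : 7 %| #|G| by rewrite oG.
have neq1 := card_Syl_neq1 radG (isT : prime 7) dv7.
have modn := card_Syl_mod G (isT : prime 7); have := card_Syl_dvd 7 G.
rewrite oG => dvn; have ltn : #|'Syl_7(G)| < 337 by rewrite ltnS dvdn_leq.
by have := Sylow7_numbers ltn; rewrite dvn modn eqxx neq1 => /eqP.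
Qed.

(** [K] contains every odd Sylow subgroup of [G], so 3 and 7 divide its order; having eight Sylow
    7-subgroups, it also has order divisible by 8. *)
Lemma normal_card_ge168 K : K <| G -> K :!=: 1 -> 168 <= #|K|.
Proof.
move=> nsKG ntK; apply: dvdn_leq => //.
have sylK p S : odd p -> p.-Sylow(G) S -> p.-Sylow(K) S.
  move=> odd_p sylS; apply: (pHall_subl _ (normal_sub nsKG) sylS).
  exact: sub_normal odd_p (pHall_sub sylS) (pHall_pgroup sylS).
have eqSyl : 'Syl_7(K) = 'Syl_7(G).
  have [Q sylQ] := Sylow_exists 7 G.
  apply/setP=> S; rewrite !inE; apply/idP/idP=> [sylS | ]; last exact: sylK.
  rewrite pHallE (subset_trans (pHall_sub sylS) (normal_sub nsKG)).
  by rewrite (card_Hall sylS) -(card_Hall sylQ) (card_Hall (sylK 7 Q isT sylQ)) eqxx.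
have dv8 : 8 %| #|K| by rewrite -nSyl -eqSyl card_Syl_dvd.
have dvp p : odd p -> #|G|`_p %| #|K|.
  move=> odd_p; have [S sylS] := Sylow_exists p G.
  by rewrite -(card_Hall sylS) cardSg // (pHall_sub (sylK p S odd_p sylS)).
have := dvp 3 isT; have := dvp 7 isT; rewrite oG !p_part.
rewrite -[168]/(8 * (7 * 3))%N => dv7 dv3.
have co8 : coprime 8 (7 * 3) by [].
have co7 : coprime 7 3 by [].
by rewrite (Gauss_dvd _ co8) (Gauss_dvd _ co7) dv8 dv7 dv3.
Qed.

(** The preimage of [L], the image of SL(2,7), is a nontrivial normal subgroup and shares [Q] with
    [K], so minimality puts [K] inside it. As [L] is proper, its order is at most 168, which [K]
    already reaches. *)
Lemma minnormal_isog_PSL27 K : minnormal K G -> K <| G -> K \isog PSL 2 'F_7.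
Proof.
move=> minK nsKG; have /mingroupP[/andP[ntK _] minKG] := minK.
have [Q sylQ] := Sylow_exists 7 G.
have oQ : #|Q| = 7 by rewrite (card_Hall sylQ) oG p_part.
have [R sylR neqQR] : exists2 R : {group gT}, 7.-Sylow(G) R & R != Q.
  have /subsetPn[R] : ~~ ('Syl_7(G) \subset [set Q]).
    by apply/negP=> /subset_leq_card; rewrite nSyl cards1.
  by rewrite !inE => sylR neqQR; exists R.
have faithG := Syl_faithful Gx nilH radG p2x (isT : prime 7) isT sylQ sylR neqQR oQ.
have [f inj_f im_f] := ex_mobius_isom oG nSyl sylQ sylR neqQR oQ faithG.
pose L := (@mobius 'F_7 @* SL 2 'F_7)%G.
have nsL : L <| f @* G by rewrite im_f; apply: morphim_normal; apply: SL_normal.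
have sLG := normal_sub nsL.
have nsN : (f @*^-1 L)%G <| G.
  by have := morphpre_normal sLG (subxx (f @* G)); rewrite nsL injmK.
have fN : f @* (f @*^-1 L) = L by apply: morphpreK.
have [g Gg fg] : exists2 g, g \in G & f g = mobius (gl2 1%R 0%R 1%R 1%R).
  have : mobius (gl2 1%R 0%R 1%R 1%R) \in f @* G.
    by rewrite im_f; apply: mem_morphim; apply: in_setT.
  by case/morphimP=> g Gg _ ->; exists g.
have ntN : f @*^-1 L != 1.
  apply: contraTneq mobius_shift_SL => N1; rewrite -[_ @* _]fN N1 morphim1.
  apply/set1P=> /permP/(_ (Some 0%R)); rewrite mobius_gl2 // perm1 => /eqP.
  by [].
have ntKN : K :&: (f @*^-1 L)%G != 1.
  have sQK := sub_normal nsKG ntK (isT : odd 7) (pHall_sub sylQ) (pHall_pgroup sylQ).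
  have sQN := sub_normal nsN ntN (isT : odd 7) (pHall_sub sylQ) (pHall_pgroup sylQ).
  rewrite -cardG_gt1 (leq_trans _ (subset_leq_card (_ : Q \subset _))) ?oQ //.
  by rewrite subsetI sQK.
have sKN : K \subset f @*^-1 L.
  have nsKN : K :&: (f @*^-1 L)%G <| G by apply: normalI.
  have <- : K :&: (f @*^-1 L)%G = K.
    by apply: (minKG (K :&: (f @*^-1 L))%G); rewrite ?subsetIl // ntKN normal_norm.
  exact: subsetIr.
have oIm : #|f @* G| = 336 by rewrite card_injm.
have leL : #|L| <= 168.
  have ltL : #|L| < 336.
    rewrite -oIm proper_card // properE sLG; apply: contra mobius_scale_notin_SL.
    by move/subsetP; apply; rewrite im_f; apply: mem_morphim; apply: in_setT.
  have /dvdnP[k oG'] : #|L| %| 336 by rewrite -oIm cardSg.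
  case: k oG' => [|[|k]] oG' //; first by rewrite oG' mul1n ltnn in ltL.
  have : 2 * #|L| <= 2 * 168 by rewrite -[X in _ <= X]/336 [X in _ <= X]oG' leq_mul2r orbT.
  by rewrite leq_pmul2l.
have fK : f @* K = L.
  apply/eqP; rewrite eqEcard; apply/andP; split.
    by rewrite sub_morphim_pre // normal_sub.
  by rewrite (card_injm inj_f) ?normal_sub // (leq_trans leL) ?normal_card_ge168.
(* The centre of [K] is an abelian normal subgroup of [G], so the trivial soluble radical supplies
   what [isog_PSL2_mobius] asks for. *)
have ZL : 'Z(L) = 1.
  rewrite -fK -(injm_center inj_f (normal_sub nsKG)).
  rewrite (radG (gFnormal_trans _ nsKG)) ?morphim1 //.
  by rewrite abelian_sol ?center_abelian.
have isoKL := sub_isog (normal_sub nsKG) inj_f; rewrite fK in isoKL.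
have isoLP : L \isog PSL 2 'F_7 by rewrite isog_sym; apply: isog_PSL2_mobius ZL.
exact: isog_trans isoKL isoLP.
Qed.

End PSL27.

(** * PGL(2,7) has an element with soluble overgroups of 2-power order *)

Section Rotations.

Variable F : finFieldType.
Local Open Scope ring_scope.
Implicit Types (A B : {'GL_2[F]}) (a b c d : F).

Lemma gl2_eta A : A = gl2 (GLval A 0 0) (GLval A 0 1) (GLval A 1 0) (GLval A 1 1).
Proof.
have := GL_det A; rewrite det_mx2 => nz.
apply: val_inj; rewrite -[LHS]/(GLval A) -[RHS]/(GLval _) gl2E //.
by apply: eq_mx2; rewrite !mxE.
Qed.

Lemma gl2M a b c d a' b' c' d' :
    a * d - b * c != 0 -> a' * d' - b' * c' != 0 ->
  (gl2 a b c d * gl2 a' b' c' d')%g =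
    gl2 (a * a' + b * c') (a * b' + b * d') (c * a' + d * c') (c * b' + d * d').
Proof.
move=> nz nz'; rewrite [LHS]gl2_eta.
by congr gl2; rewrite GL_MxE !gl2E // !mxE big_I2 !mxE.
Qed.

(* The matrices a + b J, where J ^ 2 = -1. *)
Definition cmx a b := gl2 a b (- b) a.

Lemma cmx_det a b : a * a - b * (- b) = a ^+ 2 + b ^+ 2.
Proof. by ring. Qed.

Lemma mobius_cmx_sqr a b : a ^+ 2 + b ^+ 2 != 0 ->
  (mobius (cmx a b) ^+ 2)%g = mobius (cmx (a ^+ 2 - b ^+ 2) (2 * a * b)).
Proof.
move=> nz; rewrite expgS expg1 -mobius_mulg /cmx gl2M ?cmx_det //.
have -> : a * a + b * (- b) = a ^+ 2 - b ^+ 2 by ring.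
have -> : a * b + b * a = 2 * a * b by ring.
have -> : - b * a + a * - b = - (2 * a * b) by ring.
by have -> : - b * b + a * a = a ^+ 2 - b ^+ 2 by ring.
Qed.

Lemma cmx_sqr_det a b : a ^+ 2 + b ^+ 2 != 0 ->
  (a ^+ 2 - b ^+ 2) ^+ 2 + (2 * a * b) ^+ 2 != 0.
Proof.
move=> nz; have -> : (a ^+ 2 - b ^+ 2) ^+ 2 + (2 * a * b) ^+ 2 = (a ^+ 2 + b ^+ 2) ^+ 2.
  by ring.
by rewrite expf_neq0.
Qed.

Lemma mobius_cmx_eq1 a b : a ^+ 2 + b ^+ 2 != 0 -> mobius (cmx a b) = 1%g -> b = 0.
Proof.
move=> nz /mobius_eq1/matrixP/(_ 0 1); rewrite !gl2E ?cmx_det // !mxE /=.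
by rewrite mulr0n.
Qed.

Lemma mobius_cmx0 a : a != 0 -> mobius (cmx a 0) = 1%g.
Proof.
move=> nz_a; have nz : a ^+ 2 + 0 ^+ 2 != 0 by rewrite expr0n addr0 expf_neq0.
rewrite -(mobius1 F); apply: (@mobius_scale _ _ _ a).
rewrite gl2E ?cmx_det // GL_1E.
by apply: eq_mx2; rewrite !mxE oppr0 /= ?mulr1n ?mulr0n ?mulr1 ?mulr0.
Qed.

Lemma mobius_cmxJ b : b != 0 -> mobius (cmx 0 b) = mobius (cmx 0 1).
Proof.
move=> nz_b; apply: (@mobius_scale _ _ _ b).
rewrite !gl2E ?cmx_det ?expr0n ?add0r ?expf_neq0 ?oner_neq0 //.
by apply: eq_mx2; rewrite !mxE /= ?mulr0 ?mulr1 ?mulrN1.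
Qed.

(** Commuting modulo scalars means A J = c J A, and comparing entries gives c ^ 2 = 1. The sign of c
    separates rotations from reflections. *)
Lemma mobius_centJ A : commute (mobius A) (mobius (cmx 0 1)) ->
    (exists a b, A = cmx a b /\ a ^+ 2 + b ^+ 2 != 0) \/
  (exists a b, A = gl2 a b b (- a) /\ a ^+ 2 + b ^+ 2 != 0).
Proof.
rewrite /commute -!mobius_mulg => /mobius_eqP[c].
rewrite [A]gl2_eta; have := GL_det A; rewrite det_mx2.
move: (GLval A 0 0) (GLval A 0 1) (GLval A 1 0) (GLval A 1 1) => a b b' a' nz.
have nzJ : (0 : F) * 0 - 1 * (- 1) != 0 by rewrite mul0r mul1r opprK add0r oner_neq0.
rewrite /cmx !GL_MxE !gl2E // => /matrixP eqM.
have := eqM 1 1; have := eqM 1 0; have := eqM 0 1; have := eqM 0 0.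
rewrite !mxE !big_I2 !mxE /= !(mulr0, mul0r, addr0, add0r, mulr1, mul1r, mulrN, mulNr).
move=> eb ea eb' ea'.
have {eb'}defa' : a' = c * a by apply: oppr_inj.
have {ea'}defb' : b' = - (c * b) by [].
have c2b : c ^+ 2 * b = b by rewrite defb' in eb; apply: oppr_inj; rewrite eb; ring.
have c2a : c ^+ 2 * a = a by rewrite {2}ea defa'; ring.
have c2 : (c == 1) || (c == -1).
  rewrite -eqf_sqr expr1n -subr_eq0; apply: contraNT nz => nzc.
  have a0 : a = 0.
    by apply/eqP; rewrite -(mulrI_eq0 _ (mulfI nzc)) mulrBl mul1r c2a subrr.
  have b0 : b = 0.
    by apply/eqP; rewrite -(mulrI_eq0 _ (mulfI nzc)) mulrBl mul1r c2b subrr.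
  by rewrite a0 b0 !mul0r subrr.
case/orP: c2 => /eqP def_c; [left | right]; exists a, b; split.
- by rewrite defa' defb' def_c !mul1r.
- by move: nz; rewrite defa' defb' def_c !mul1r cmx_det.
- by rewrite defa' defb' def_c !mulN1r opprK.
move: nz; rewrite defa' defb' def_c !mulN1r opprK.
have -> : a * - a - b * b = - (a ^+ 2 + b ^+ 2) by ring.
by rewrite oppr_eq0.
Qed.

(* Modulo scalars, the reflection gl2 a b b (- a) inverts the rotation cmx c d. *)
Lemma mobius_reflJ a b c d : a ^+ 2 + b ^+ 2 != 0 -> c ^+ 2 + d ^+ 2 != 0 ->
  (mobius (cmx c d) * mobius (gl2 a b b (- a)) * mobius (cmx c d) =
    mobius (gl2 a b b (- a)))%g.
Proof.
move=> nz nz'; rewrite -!mobius_mulg; apply: (@mobius_scale _ _ _ (c ^+ 2 + d ^+ 2)).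
have nzA : a * - a - b * b != 0.
  have -> : a * - a - b * b = - (a ^+ 2 + b ^+ 2) by ring.
  by rewrite oppr_eq0.
rewrite !GL_MxE !gl2E ?cmx_det //.
by apply: eq_mx2; rewrite !mxE !big_I2 !mxE !big_I2 !mxE /=; ring.
Qed.

Lemma mobius_refl_sqr a b : a ^+ 2 + b ^+ 2 != 0 ->
  (mobius (gl2 a b b (- a)) ^+ 2 = 1)%g.
Proof.
move=> nz; rewrite expgS expg1 -mobius_mulg -(mobius1 F).
apply: (@mobius_scale _ _ _ (a ^+ 2 + b ^+ 2)).
have nzA : a * - a - b * b != 0.
  have -> : a * - a - b * b = - (a ^+ 2 + b ^+ 2) by ring.
  by rewrite oppr_eq0.
rewrite GL_MxE !gl2E // GL_1E.
by apply: eq_mx2; rewrite !mxE !big_I2 !mxE /= ?mulr1n ?mulr0n; ring.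
Qed.

End Rotations.

Section PGL27.

Let expg4 (gT : finGroupType) (y : gT) : y ^+ 4 = (y ^+ 2) ^+ 2.
Proof. by rewrite -expgM. Qed.

Let expg8 (gT : finGroupType) (y : gT) : y ^+ 8 = ((y ^+ 2) ^+ 2) ^+ 2.
Proof. by rewrite -!expgM. Qed.

Local Notation H := (@mobius 'F_7 @* [set: {'GL_2['F_7]}])%G.
Local Notation X := (mobius (cmx (1 : 'F_7)%R 2%R)).
Local Notation J := (mobius (cmx (0 : 'F_7)%R 1%R)).
Implicit Types (S E : {group {perm option 'F_7}}).

Lemma card_PGL27 : #|H| = 336.
Proof.
have F7 : #|(('F_7) : finFieldType)| = 7 by rewrite card_Fp.
by rewrite [LHS]card_mobius F7.
Qed.

Lemma PGL27_X : X \in H.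
Proof. by apply: mem_morphim; apply: in_setT. Qed.

(** (1 + 2 J) ^ 2 = -3 + 4 J, and the square of this is 4 J modulo 7. So [X] has order 8. *)
Lemma expgX4 : X ^+ 4 = J.
Proof.
have nz : ((1 : 'F_7) ^+ 2 + 2 ^+ 2 != 0)%R by vm_compute.
rewrite expg4 (mobius_cmx_sqr nz) (mobius_cmx_sqr (cmx_sqr_det nz)).
have -> : (((1 : 'F_7) ^+ 2 - 2 ^+ 2) ^+ 2 - (2 * 1 * 2) ^+ 2 = 0)%R.
  by apply: val_inj; vm_compute.
by apply: mobius_cmxJ; vm_compute.
Qed.

Let nzJ : ((0 : 'F_7) ^+ 2 + 1 ^+ 2 != 0)%R. Proof. by vm_compute. Qed.

Lemma sqrgJ : J ^+ 2 = 1.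
Proof.
rewrite (mobius_cmx_sqr nzJ) mulr0 mul0r.
by apply: mobius_cmx0; vm_compute.
Qed.

Lemma J_neq1 : J != 1.
Proof. by apply/eqP => /(mobius_cmx_eq1 nzJ)/eqP; rewrite oner_eq0. Qed.

Lemma cmx_sqr_eq1 (a b : 'F_7) : (a ^+ 2 + b ^+ 2 != 0)%R ->
  mobius (cmx a b) ^+ 2 = 1 -> mobius (cmx a b) = 1 \/ mobius (cmx a b) = J.
Proof.
move=> nz; rewrite mobius_cmx_sqr // => /(mobius_cmx_eq1 (cmx_sqr_det nz))/eqP.
rewrite !mulf_eq0 => /orP[/orP[//|]|] /eqP z0; [right | left].
  rewrite z0; apply: mobius_cmxJ; apply: contraNneq nz => ->.
  by rewrite z0 expr0n addr0.
rewrite z0; apply: mobius_cmx0; apply: contraNneq nz => ->.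
by rewrite z0 expr0n addr0.
Qed.

(** -1 is not a square modulo 7, so the matrices a + b J form a field of 49 elements, whose units
    modulo scalars have order 48 / 6 = 8. The proof checks all pairs. *)
Lemma cmx_exp8 (a b : 'F_7) : (a ^+ 2 + b ^+ 2 != 0)%R -> mobius (cmx a b) ^+ 8 = 1.
Proof.
move=> nz; have nz2 := cmx_sqr_det nz; have nz4 := cmx_sqr_det nz2.
have nz8 := cmx_sqr_det nz4.
rewrite expg8 (mobius_cmx_sqr nz) (mobius_cmx_sqr nz2) (mobius_cmx_sqr nz4).
have main c d : d = 0%R -> (c ^+ 2 + d ^+ 2 != 0)%R -> mobius (cmx c d) = 1.
  move=> -> nzc; apply: mobius_cmx0; apply: contraNneq nzc => ->.
  by rewrite expr0n addr0.
apply: main nz8; move: a b {nz nz2 nz4}.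
by move=> [[|[|[|[|[|[|[|a]]]]]]] lta] [[|[|[|[|[|[|[|b]]]]]]] ltb] //;
  apply: val_inj; vm_compute.
Qed.

Lemma centJ_2group : 2.-group 'C_H[J].
Proof.
apply/pgroupP=> p pr_p /(Cauchy pr_p)[g /setIP[Hg /cent1P cgJ] og].
have g8 : g ^+ 8 = 1.
  have /morphimP[A _ _ defg] := Hg; rewrite {}defg /= in cgJ *.
  have [[a [b [-> nz]]] | [a [b [-> nz]]]] := mobius_centJ cgJ.
    exact: cmx_exp8.
  by rewrite expg8 mobius_refl_sqr // !expg1n.
have : p %| 2 ^ 3 by rewrite -og order_dvdn g8.
by rewrite Euclid_dvdX // dvdn_prime2 // => /andP[/eqP-> _].
Qed.

(** [J] is the only involution among the rotations, and reflections invert [X]. The third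
    alternative is this inversion, in the form that the soluble overgroup argument uses. *)
Lemma centJ_involution g : g \in 'C_H[J] -> g ^+ 2 = 1 ->
  [\/ g = 1, g = J | X * g * X = g].
Proof.
case/setIP=> /morphimP[A _ _ /= defg] /cent1P cgJ g2.
have cAJ : commute (mobius A) J by rewrite -defg.
have [[a [b [defA nz]]] | [a [b [defA nz]]]] := mobius_centJ cAJ;
  rewrite {}defA in defg; rewrite defg in g2.
  have [eg | eg] := cmx_sqr_eq1 nz g2.
    by apply: Or31; exact (etrans defg eg).
  by apply: Or32; exact (etrans defg eg).
have nzX : ((1 : 'F_7) ^+ 2 + 2 ^+ 2 != 0)%R by vm_compute.
have e := mobius_reflJ nz nzX.
exact (Or33 _ _ (etrans (congr1 (fun y => X * y * X) defg) (etrans e (esym defg)))).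
Qed.

End PGL27.

(** * Long commutators *)

Section LongCommutators.

Variable gT : finGroupType.
Implicit Types (G H K : {group gT}) (s : seq gT).

Lemma long_commg_rcons s y : s != [::] -> long_commg (rcons s y) = [~ long_commg s, y].
Proof. by case: s => [//|z s] _; rewrite /= foldl_rcons. Qed.

Lemma long_commg_lcn G s n :
  size s = n.+1 -> {subset s <= G} -> long_commg s \in 'L_n.+1(G).
Proof.
elim: n s => [|n IHn] s; case/lastP: s => // s y; rewrite size_rcons => [[szs]] sG.
  by rewrite (size0nil szs) /= lcn1 sG // (size0nil szs) inE.
rewrite long_commg_rcons -?size_eq0 ?szs // lcnSn mem_commg //.
  by apply: IHn => // z sz; rewrite sG // mem_rcons inE sz orbT.
by rewrite sG // mem_rcons inE eqxx.
Qed.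

(** Each further entry of a commutator descends one step in the upper central series. This series is
    used because being in ['Z_i.+1(G)] is tested on single commutators with elements of [G]. *)
Lemma long_commg_ucn k G i s :
    (forall s, size s = k -> {subset s <= G} -> long_commg s = 1) ->
    0 < size s -> (size s + i)%N = k -> {subset s <= G} ->
  long_commg s \in 'Z_i(G).
Proof.
move=> triv; elim: i s => [|i IHi] s s_gt0 szs sG.
  by rewrite ucn0 triv ?inE // -szs addn0.
have memG : long_commg s \in G.
  have := @long_commg_lcn G s (size s).-1; rewrite prednK // => /(_ erefl sG).
  by apply: subsetP; apply: lcn_sub.
rewrite ucnSnR inE memG gen_subG; apply/subsetP=> _ /imset2P[_ y /set1P-> Gy ->].
rewrite -long_commg_rcons -?size_eq0 -?lt0n //; apply: IHi.
- by rewrite size_rcons.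
- by rewrite size_rcons addSnnS.
by move=> z; rewrite mem_rcons inE => /predU1P[->|/sG].
Qed.

Lemma long_commg_nilpotent k G : 0 < k ->
  (forall s, size s = k -> {subset s <= G} -> long_commg s = 1) -> nilpotent G.
Proof.
move=> k_gt0 triv; apply/ucnP; exists k.-1.
apply/eqP; rewrite eqEsubset ucn_sub; apply/subsetP=> y Gy.
have := @long_commg_ucn k G k.-1 [:: y] triv isT; apply; last by move=> z /[1!inE] /eqP->.
by rewrite add1n prednK.
Qed.

Lemma sub_solubilizer_nilpotent k G H x : 0 < k ->
  trivial_long_comm_sol k G x -> H \subset solubilizer G x -> nilpotent H.
Proof.
move=> k_gt0 triv sHS; apply: (long_commg_nilpotent k_gt0) => s szs sH.
subst k; apply: (triv (in_tuple s)) => i.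
by rewrite (subsetP sHS) // sH // (mem_tnth i (in_tuple s)).
Qed.

End LongCommutators.

(** * Soluble overgroups of an element of order 8 *)

Fact odd_divisor_336 n : n < 337 ->
  if n %| 336 then if odd n then n \in [:: 1; 3; 7; 21]%N else true else true.
Proof. by move: n; apply: all_iotaP; vm_compute. Qed.

Section Witness.

Variables (gT : finGroupType) (H : {group gT}) (x j : gT).
Implicit Types (S E : {group gT}).

Hypotheses (oH : #|H| = 336) (Hx : x \in H) (x4 : x ^+ 4 = j).
Hypotheses (j2 : j ^+ 2 = 1) (ntj : j != 1) (pC : 2.-group 'C_H[j]).
Hypothesis centP2 : forall g, g \in 'C_H[j] -> g ^+ 2 = 1 ->
  [\/ g = 1, g = j | x * g * x = g].

Let x8 : x ^+ 8 = 1. Proof. by rewrite (expgM x 4 2) x4. Qed.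

Lemma expgJ_cycle e k n : e ^ x = e ^+ k -> e ^ (x ^+ n) = e ^+ (k ^ n).
Proof.
move=> ek; elim: n => [|n IHn]; first by rewrite expg0 conjg1 expg1.
by rewrite expgSr conjgM IHn conjXg ek -expgM expnS.
Qed.

(** A minimal normal subgroup [E] of [S] is elementary abelian. It cannot have odd order, and if it
    is a 2-group it is generated by [j], which is then central in [S]. *)
Lemma solvable_sub_cent S : S \subset H -> x \in S -> solvable S -> S \subset 'C_H[j].
Proof.
move=> sSH Sx solS; have Sj : j \in S by rewrite -x4 groupX.
have ntS : S :!=: 1.
  by apply: contraNneq ntj => S1; rewrite -in_set1 -[[set 1]]/(1 : {set _}) -S1.
have [E minE sES] := minnormal_exists ntS (normG S).
have [nES ntE /is_abelemP[p pr_p abE]] := minnormal_solvable minE sES solS.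
have pE := abelem_pgroup abE.
have cEE := abelem_abelian abE.
have sEH := subset_trans sES sSH.
have cxj : commute x j by rewrite -x4; apply/commuteX.
have nEx : <[x]> \subset 'N(E) by rewrite cycle_subG (subsetP nES).
have [p2 | odd_p] := eqVneq p 2.
  rewrite p2 in pE abE.
  have expE t : t \in E -> t ^+ 2 = 1.
    by have [_] := abelemP (isT : prime 2) abE; apply.
  have p2x : 2.-group <[x]>.
    by rewrite /pgroup -orderE (pnat_dvd (_ : #[x] %| 2 ^ 3)) ?order_dvdn ?x8 ?eqxx ?pnatX.
  (* The 2-group generated by [x] fixes some [e != 1] in [E]. If [x] inverted by [e] were the case,
     commutation would give [x ^+ 2 = 1], against [j != 1]. *)
  have Ej : j \in E.
    have := pgroup_fix_mod p2x (_ : [acts <[x]>, on E | 'J]).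
    rewrite astabsJ => /(_ nEx); rewrite afixJ => eqm.
    have evE : 2 %| #|'C_E(<[x]>)|.
      rewrite /dvdn -eqm -[_ == _]/(2 %| #|E|).
      by have [_ ? _] := pgroup_pdiv pE ntE.
    have /trivgPn[e /setIP[Ee cxe] nte] : 'C_E(<[x]>) != 1.
      by rewrite trivg_card1; apply: contraTneq evE => ->.
    rewrite /= cent_cycle in cxe; have /cent1P cex := cxe.
    have Ce : e \in 'C_H[j].
      rewrite inE (subsetP sEH) //=; apply/cent1P.
      by rewrite -x4; apply/commuteX.
    have [e1 | <- // | xex] := centP2 Ce (expE e Ee); first by rewrite e1 eqxx in nte.
    case/negP: ntj; rewrite -x4 (expgM x 2 2) (_ : x ^+ 2 = 1) ?expg1n //.
    by apply: (mulIg e); rewrite mul1g -{2}xex expgS expg1 -mulgA -mulgA cex.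
  have EP t : t \in E -> t = 1 \/ t = j.
    move=> Et; have Ct : t \in 'C_H[j].
      by rewrite inE (subsetP sEH) //=; apply/cent1P/(centsP cEE).
    have [-> | -> | xtx] := centP2 Ct (expE t Et); [by left | by right |].
    (* When [t] inverts [x], [x ^+ 2] is the commutator of [t] and [x]; exponent 2 of [E] then
       forces [x ^+ 4 = 1]. *)
    have Ex2 : x ^+ 2 \in E.
      have -> : x ^+ 2 = t^-1 * t ^ x.
        rewrite conjgE; apply: (mulgI t); rewrite mulKVg.
        by apply: (mulgI x); rewrite mulKVg [x ^+ 2]expgS expg1 !mulgA xtx.
      rewrite groupM ?groupV // memJ_norm //.
      by rewrite (subsetP nEx) ?cycle_id.
    by case/negP: ntj; rewrite -x4 (expgM x 2 2) expE.
  rewrite subsetI sSH sub_cent1; apply/centP=> s Ss.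
  have Ejs : j ^ s \in E by rewrite memJ_norm // (subsetP nES).
  apply/commgP/conjg_fixP; have [/eqP|//] := EP _ Ejs.
  by rewrite conjg_eq1 (negPf ntj).
have [_ dvpE [m oE]] := pgroup_pdiv pE ntE.
have dvE : #|E| %| 336 by rewrite -oH cardSg.
have oE37 : #|E| = 3 \/ #|E| = 7.
  have ltE : #|E| < 337 by rewrite ltnS dvdn_leq.
  have oddE : odd #|E| by rewrite oE oddX orbC; case: (even_prime pr_p) odd_p => [-> | ->].
  have := odd_divisor_336 ltE; rewrite dvE oddE !inE => /or4P[] /eqP o; [| by left | by right |].
    by case/negP: ntE; rewrite trivg_card1 o.
  by move: pE; rewrite /pgroup o /pnat /= !inE => /and3P[/eqP<-].
have prE : prime #|E| by case: oE37 => ->.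
have [e defE] := cyclicP (prime_cyclic prE).
have Ee : e \in E by rewrite defE cycle_id.
have nte : e != 1 by rewrite -cycle_eq1 -defE.
have oe : #[e] = #|E| by rewrite defE.
have /cyclePmin[k ltk ek] : e ^ x \in <[e]>.
  by rewrite -defE memJ_norm // (subsetP nEx) ?cycle_id.
(* Automorphism groups of groups of order 3 and 7 have exponent dividing 6. As [x ^+ 8 = 1], [j] is
   the square of [x ^+ 6], so it centralises [E], impossible in the 2-group ['C_H[j]]. *)
have x6 : e ^ (x ^+ 6) = e.
  rewrite (expgJ_cycle 6 ek) -[RHS]expg1; apply/eqP; rewrite eq_expg_mod_order.
  have nzk : k != 0 by apply: contraNneq nte => k0; rewrite -(conjg_eq1 e x) ek k0.
  by move: ltk nzk; rewrite oe; case: oE37 => ->; case: k {ek} => [|[|[|[|[|[|[|]]]]]]] //;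
    vm_compute.
have cje : e ^ j = e.
  by rewrite -x4 -[x ^+ 4]mul1g -x8 -expgD (expgM x 6 2) expgS expg1 conjgM !x6.
have Ce : e \in 'C_H[j].
  by rewrite inE (subsetP sEH) //=; apply/cent1P/commgP/conjg_fixP.
have := mem_p_elt pC Ce; rewrite /p_elt oe.
by case: oE37 => ->.
Qed.

Lemma card_cent_j : #|'C_H[j]| %| 16.
Proof.
have : #|'C_H[j]| %| 336 by rewrite -oH cardSg ?subsetIl.
rewrite -[336]/(16 * 21)%N Gauss_dvdl //.
by apply: (@pnat_coprime 2); rewrite // -[pnat _ _]/(2.-group _).
Qed.

Lemma witness_insoluble : ~~ solvable H.
Proof.
apply/negP=> solH; have sHC := solvable_sub_cent (subxx H) Hx solH.
by have := pgroupS sHC pC; rewrite /pgroup oH.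
Qed.

(** The solubilizer lies in ['C_H[j]], a 2-group of order at most 16 and so of class at most 3. *)
Lemma witness_trivial_long_comm k : 4 <= k -> trivial_long_comm_sol k H x.
Proof.
case: k => // k k_gt3 u sol_u.
have uC y : y \in u -> y \in 'C_H[j].
  case/tnthP=> i ->; have := sol_u i; rewrite inE => /andP[Hy soly].
  have := solvable_sub_cent (S := <<[set x; tnth u i]>>%G).
  rewrite gen_subG subUset !sub1set Hx Hy mem_gen ?set21 //.
  by move=> /(_ isT isT soly)/subsetP; apply; rewrite mem_gen ?set22.
have := long_commg_lcn (size_tuple u) uC.
suff -> : 'L_k.+1('C_H[j]) = 1 by move/set1P.
apply/(lcn_nil_classP k (pgroup_nil pC)).
apply: leq_trans (nil_class_pgroup pC) _.
rewrite geq_max (leq_trans _ (k_gt3 : 3 <= k)) //=.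
have le4 : logn 2 #|'C_H[j]| <= 4 by apply: (@dvdn_leq_log 2 _ 16) card_cent_j.
by rewrite -subn1 leq_subLR add1n (leq_trans le4).
Qed.

End Witness.

Lemma PGL27_insoluble_with_trivial_long_comm k : 4 <= k ->
  insoluble_with_trivial_long_comm k (@mobius 'F_7 @* [set: {'GL_2['F_7]}])%G.
Proof.
move=> hk; split.
  exact: (witness_insoluble card_PGL27 PGL27_X expgX4 sqrgJ J_neq1
            centJ_2group centJ_involution).
exists (mobius (cmx (1 : 'F_7)%R 2%R)); first exact: PGL27_X.
exact: (witness_trivial_long_comm card_PGL27 PGL27_X expgX4 sqrgJ J_neq1
          centJ_2group centJ_involution hk).
Qed.

(** * Reduction to trivial soluble radical *)

Section Reduction.

Variables (gT : finGroupType) (G : {group gT}).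
Implicit Types (N H : {group gT}) (x : gT).

Lemma solubilizerS H x : H \subset G -> solubilizer H x \subset solubilizer G x.
Proof. by move=> sHG; apply/subsetP=> y; rewrite !inE => /andP[/(subsetP sHG)-> ->]. Qed.

Lemma trivial_long_comm_solS k H x :
  H \subset G -> trivial_long_comm_sol k G x -> trivial_long_comm_sol k H x.
Proof.
by move=> sHG triv u Hu; apply: triv => i; apply: subsetP (Hu i); apply: solubilizerS.
Qed.

Lemma solubilizer1 : solubilizer G 1 = G.
Proof.
apply/setP=> y; rewrite inE; case Gy: (y \in G) => //=.
have -> : <<[set 1; y]>> = <[y]>.
  apply/eqP; rewrite eqEsubset gen_subG subUset !sub1set group1 cycle_id /=.
  by rewrite cycle_subG mem_gen ?set22.
by rewrite abelian_sol ?cycle_abelian.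
Qed.

Lemma mem_solubilizer_quotient N x y : N <| G -> solvable N -> x \in G -> y \in G ->
  coset N y \in solubilizer (G / N) (coset N x) -> y \in solubilizer G x.
Proof.
move=> nsNG solN Gx Gy; rewrite !inE Gy => /andP[_ solq] /=.
have nN := subsetP (normal_norm nsNG).
set A := <<_>>; have sAG : A \subset G by rewrite gen_subG subUset !sub1set Gx.
have nAN : A \subset 'N(N) := subset_trans sAG (normal_norm nsNG).
have nsI : N :&: A <| A by rewrite /normal subsetIr normsI ?normG.
rewrite (series_sol nsI) (solvableS (subsetIl _ _) solN) /=.
rewrite (isog_sol (second_isog nAN)) /=.
suff -> : A / N = <<[set coset N x; coset N y]>> by [].
by rewrite quotient_gen ?subUset ?sub1set ?nN // quotientU !quotient_set1 ?nN.
Qed.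

Lemma coset_long_commg N (s : seq gT) : {subset s <= 'N(N)} ->
  coset N (long_commg s) = long_commg (map (coset N) s).
Proof.
elim/last_ind: s => [|s y IHs] sN; first by rewrite /= morph1.
have [-> // | nts] := eqVneq s [::].
have sN' : {subset s <= 'N(N)} by move=> z sz; rewrite sN // mem_rcons inE sz orbT.
have Ns : long_commg s \in 'N(N).
  case: s nts sN' {IHs sN} => // z s _ sN'.
  have := @long_commg_lcn _ 'N(N)%G (z :: s) (size s) erefl sN'.
  by apply: subsetP; apply: lcn_sub.
rewrite map_rcons !long_commg_rcons -?size_eq0 ?size_map ?size_eq0 //.
have Ny : y \in 'N(N) by rewrite sN // mem_rcons inE eqxx.
by rewrite morphR //= IHs.
Qed.

(** Arbitrary lifts of the entries lie in the solubilizer, since a soluble kernel does not affect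
    solubility. Thus a nontrivial soluble [N] would give a smaller example, contradicting
    minimality. *)
Lemma trivial_long_comm_sol_quotient k N x :
    N <| G -> solvable N -> x \in G -> trivial_long_comm_sol k G x ->
  trivial_long_comm_sol k (G / N) (coset N x).
Proof.
move=> nsNG solN Gx triv u solu; have nN := subsetP (normal_norm nsNG).
have ex_v i : exists y, (y \in G) && (coset N y == tnth u i).
  have := solu i; rewrite inE => /andP[/morphimP[y Ny Gy ->] _].
  by exists y; rewrite Gy eqxx.
pose v := [tuple xchoose (ex_v i) | i < k].
have vP i : tnth v i \in G /\ coset N (tnth v i) = tnth u i.
  by rewrite tnth_mktuple; have /andP[? /eqP] := xchooseP (ex_v i).
have uE : val u = map (coset N) (val v).
  have -> : u = [tuple of map (coset N) v] => //.
  by apply: eq_from_tnth => i; rewrite tnth_map; have [_ ->] := vP i.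
rewrite uE -coset_long_commg; last first.
  by move=> _ /tnthP[i ->]; have [/nN] := vP i.
rewrite triv ?morph1 // => i; have [Gv ev] := vP i.
by apply: (mem_solubilizer_quotient nsNG solN Gx Gv); rewrite ev.
Qed.

End Reduction.

Theorem mainTheorem3 (k : nat) (hk : 4 <= k)
    (gT : finGroupType) (G : {group gT})
    (hG : minimal_insoluble_with_trivial_long_comm k G)
    (x : gT) (hx : x \in G) (hxk : trivial_long_comm_sol k G x) :
  exists K : {group gT},
    [/\ minimal_normal_subgroup G K,
        forall L : {group gT}, minimal_normal_subgroup G L -> L = K,
        exists2 S : {group gT}, direct_power_of K S &
          (exists F : finFieldType, [/\ odd #|F|, 5 <= #|F| & S \isog PSL 2 F])
          \/ S \isog 'Alt_('I_7),
        K * <[x]> = G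
      & exists2 P : {group gT}, P \in 'Syl_2(G) & solubilizer G x = P].
Proof.
have k_gt0 : 0 < k := leq_trans (isT : 0 < 4) hk.
have [[nsolG _] minG] := hG.
have leG : #|G| <= 336.
  rewrite -card_PGL27; apply: minG.
  exact: PGL27_insoluble_with_trivial_long_comm.
have ntx : x != 1.
  apply: contraNneq nsolG => x1; apply: nilpotent_sol.
  apply: (sub_solubilizer_nilpotent k_gt0 hxk).
  by rewrite x1 solubilizer1.
have solH (H : {group gT}) : x \in H -> H \proper G -> solvable H.
  move=> Hx pHG; apply: contraLR (proper_card pHG) => nsolH; rewrite -leqNgt.
  apply: minG; split => //; exists x => //.
  exact: trivial_long_comm_solS (proper_sub pHG) hxk.
have nilH (H : {group gT}) : x \in H -> H \proper G -> nilpotent H.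
  move=> Hx pHG; apply: (sub_solubilizer_nilpotent k_gt0 hxk).
  apply/subsetP=> y Hy; rewrite inE (subsetP (proper_sub pHG)) //=.
  by apply: solvableS (solH H Hx pHG); rewrite gen_subG subUset !sub1set Hx.
have radG (N : {group gT}) : N <| G -> solvable N -> N :=: 1.
  move=> nsNG solN; apply/eqP; apply: contraT => ntN.
  have := ltn_quotient ntN (normal_sub nsNG); rewrite ltnNge => /negP[].
  apply: minG; split; last exists (coset N x).
  - by apply: contra nsolG => solGN; rewrite (series_sol nsNG) solN.
  - exact: mem_quotient.
  exact: trivial_long_comm_sol_quotient.
have [M maxM _] := ex_maxover hx nsolG.
have pM2 := maxover_2group hx ntx nsolG nilH radG maxM leG.
have xM : x \in M by case/maxgroupP: maxM => /andP[].
have p2x : 2.-elt x := mem_p_elt pM2 xM.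
have oG : #|G| = 336.
  have [oG | //] := maxover_card hx ntx nsolG nilH radG maxM leG.
  by case: (card_neq240 hx nsolG nilH radG p2x oG).
have ntG : G :!=: 1 by apply: contraNneq nsolG => ->; apply: solvable1.
have [K minK sKG] := minnormal_exists ntG (normG G).
have [/andP[ntK nKG] minKG] := mingroupP minK.
have nsKG : K <| G by apply/andP.
exists K; split.
- by rewrite /minimal_normal_subgroup sKG.
- move=> L /andP[sLG /mingroupP[/andP[ntL nLG] minLG]].
  have nsLG : L <| G by apply/andP.
  have [KL1 | ntKL] := eqVneq (K :&: L) 1.
    (* Otherwise [K * L] would have at least 168 * 3 > 336 elements. *)
    have := subset_leq_card (mul_subG sKG sLG); rewrite TI_cardMg // oG leqNgt.
    have geK := normal_card_ge168 hx nilH radG p2x oG nsKG ntK.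
    have geL := normal_card_ge168 hx nilH radG p2x oG nsLG ntL.
    case/negP; apply: leq_trans (leq_mul geK (_ : 3 <= #|L|)); first by [].
    exact: leq_trans geL.
  have nKL : G \subset 'N(K :&: L) by rewrite normsI.
  apply: val_inj => /=.
  by rewrite -(minKG (K :&: L)%G) ?subsetIl ?ntKL // (minLG (K :&: L)%G) ?subsetIr ?ntKL.
(* [K] is itself PSL(2,7), so the direct power has a single factor. *)
- exists K; last first.
    left; exists 'F_7; have F7 : #|'F_7| = 7 by rewrite card_Fp.
    split; rewrite ?F7 //.
    exact: minnormal_isog_PSL27 hx nilH radG p2x oG K minK nsKG.
  exists 1%N, (fun=> K); split=> // [|_]; last exact: isog_refl.
  by rewrite big_ord_recl big_ord0 dprodg1.
- exact: (normal_mul_cycle hx nilH radG nsKG ntK).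
exists M; last exact: (maxover_solubilizer hx ntx nsolG nilH radG maxM).
have sylMM : 2.-Sylow(M) M by rewrite /pHall subxx pM2 indexgg.
have ntM : M :!=: 1.
  by apply: contraNneq ntx => M1; rewrite -in_set1 -[[set 1]]/(1 : {set gT}) -M1.
by rewrite inE; apply: (maxover_Sylow hx ntx nilH radG maxM sylMM ntM).
Qed.
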